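(* For $u>0$ and $x\ge 0$ let $X_x^u$, $L_x^u$ be the controlled state process and its regulator described in the context, with cost functional $$I(u,x)=h(u)+\limsup_{T\to\infty}\frac1T E\Bigl(\int_0^T C\bigl(X_x^u(t)\bigr)\,dt+p\,L_x^u(T)\Bigr).$$ Define $f:[0,\infty)\to[0,\infty)$ by $f(u)=\dfrac{u}{\sigma(u)^{1/H}}$. Then $$I(u,x)=h(u)+p\,u+G\bigl(f(u)\bigr),$$ where $G(v)=E\bigl(C(Z_v)\bigr)$ for $v>0$. Furthermore, $I(u,x)$ is independent of $x$.
   Context: Let $H\in[\tfrac12,1)$ and let $W_H=(W_H(t))_{t\ge 0}$ be a fractional Brownian motion with Hurst parameter $H$: a continuous zero-mean Gaussian process with $W_H(0)=0$ and $\mathrm{Cov}(W_H(s),W_H(t))=\frac12\bigl[t^{2H}+s^{2H}-|t-s|^{2H}\bigr]$ for $s,t\ge 0$. Let $\sigma:[0,\infty)\to(0,\infty)$ be a deterministic continuous function. For $x\ge 0$ and $u\ge 0$ define, for $t\ge 0$, $$L_x^u(t)=-\min\Bigl\{0,\min_{s\in[0,t]}\bigl(x-us+\sigma(u)W_H(s)\bigr)\Bigr\},\qquad X_x^u(t)=x-ut+\sigma(u)W_H(t)+L_x^u(t).$$ For $v>0$ put $Z_v=\max_{s\ge 0}\{W_H(s)-vs\}$ (almost surely finite). Standing assumptions: $p\ge 0$ is a constant; $h:[0,\infty)\to[0,\infty)$ is continuous, non-decreasing, with $\lim_{u\to\infty}h(u)=+\infty$; $C:[0,\infty)\to[0,\infty)$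 is continuous, non-decreasing, and satisfies $C(y)\le K(1+y^\gamma)$ for all $y\ge0$, for some constants $K>0$, $\gamma>0$. *)

(* Defs.v *)
From mathcomp Require Import all_boot all_order all_algebra.
From mathcomp Require Import all_classical all_reals all_analysis.

Set Implicit Arguments.
Unset Strict Implicit.
Unset Printing Implicit Defensive.

Import Order.TTheory GRing.Theory Num.Theory.
Import numFieldNormedType.Exports.

Local Open Scope classical_set_scope.
Local Open Scope ring_scope.

(* Functions on [0, oo) are represented by functions on R of which only the
   values on [0, oo) are ever constrained or used; in particular a process
   indexed by t >= 0 is a family R -> {RV P >-> R}. *)

Section gaussian.
Context (d : measure_display) (Omega : measurableType d) (R : realType)
  (P : probability Omega R).

(* The library's [normal_prob m 0] is the uniform law on [0, 1] and not the
   point mass at m, hence the case distinction. *)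
Definition gaussian_law (m s : R) (A : set (measurableTypeR R)) : \bar R :=
  if s == 0 then \d_m A else normal_prob m s A.

Definition gaussian_process (W : R -> {RV P >-> R}) : Prop :=
  forall (n : nat) (t a : 'I_n -> R), (forall i, 0 <= t i) ->
    exists m s : R, 0 <= s /\
      forall A : set (measurableTypeR R), measurable A ->
        pushforward P (fun w => \sum_(i < n) a i * W (t i) w) A
        = gaussian_law m s A.

Record fractional_brownian_motion (H : R) (W : R -> {RV P >-> R}) : Prop := {
  fbm_continuous : forall w : Omega, {within `[0, +oo[, continuous (W ^~ w)};
  fbm_start : forall w : Omega, W 0 w = 0;
  fbm_gaussian : gaussian_process W;
  fbm_mean : forall t : R, 0 <= t -> ('E_P[W t] = 0)%E;
  fbm_cov : forall s t : R, 0 <= s -> 0 <= t ->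
    covariance P (W s) (W t) =
    (2^-1 * (t `^ (2 * H) + s `^ (2 * H) - `|t - s| `^ (2 * H)))%:E
}.

End gaussian.

Section controlled_process.
Context (d : measure_display) (Omega : measurableType d) (R : realType)
  (P : probability Omega R).
Variables (W : R -> {RV P >-> R}) (sigma h C : R -> R) (p : R).

Definition netput (x u t : R) (w : Omega) : R := x - u * t + sigma u * W t w.

(* For continuous paths, [inf] over the compact interval is a minimum. *)
Definition regulator (x u t : R) (w : Omega) : R :=
  - Num.min 0 (inf [set netput x u s w | s in `[0, t]]).

Definition state (x u t : R) (w : Omega) : R :=
  netput x u t w + regulator x u t w.

(* [inf] and [sup] over R default to 0 on unbounded sets; for [all_time_max]
   this concerns only the null event on which the maximum is infinite. *)
Definition all_time_max (v : R) (w : Omega) : R :=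
  sup [set W s w - v * s | s in `[0, +oo[].

Definition running_cost (x u T : R) (w : Omega) : R :=
  \int[lebesgue_measure]_(t in `[0, T]) C (state x u t w)
  + p * regulator x u T w.

Definition cost (u x : R) : \bar R :=
  ((h u)%:E
   + limf_esup (fun T : R => (T^-1)%:E * 'E_P[running_cost x u T]) +oo_R)%E.

Definition G (v : R) : \bar R := 'E_P[fun w => C (all_time_max v w)]%E.

End controlled_process.

Definition scaled_rate (R : realType) (H : R) (sigma : R -> R) (u : R) : R :=
  u / sigma u `^ H^-1.

(* Main.v *)
Require Import Defs.
From mathcomp Require Import all_boot all_order all_algebra.
From mathcomp Require Import all_classical all_reals all_analysis.
From mathcomp Require Import measurable_realfun ring lra zify.
Import Order.TTheory GRing.Theory Num.Theory.
Import numFieldNormedType.Exports.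
Local Open Scope classical_set_scope.
Local Open Scope ring_scope.

Set Implicit Arguments.
Unset Strict Implicit.
Unset Printing Implicit Defensive.

(** Write [Y t = sigma u * W t - u * t].  The state at time [t] is the larger
    of [x + Y t] and of the maximum of [Y t - Y s] over [0 <= s <= t]
    ([le_state]).  Fractional Brownian motion has stationary increments and its
    law is not changed by reversing time, so for fixed [t] the state has the
    law of the larger of [x + Y t] and of the maximum of [Y] over [[0, t]]
    ([state_same_law]).  As [t] grows, [Y t] tends to minus infinity, so this
    dual variable converges almost surely to the all-time maximum of [Y]
    ([dual_cvg]), and by dominated convergence [E F(state)] converges for every
    continuous non-decreasing [F] of polynomial growth ([state_mean_cvg]).  The
    starting point [x] has disappeared from the limit.  By self-similarity the
    all-time maximum of [Y] has the law of [Z_v] with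
    [v = u / sigma(u)^(1/H)] ([peak_same_law]).

    The long-run average of a function that converges has the same limit
    ([cesaro_cvg]); with [F = C] this gives the term [E C(Z_v)].  The regulator
    is [state - x + u T - sigma(u) W_T]; its expectation is [u T] up to a
    bounded quantity, by the convergence above with [F] the identity, and this
    gives the term [p u].

    Two facts carry this argument.

    - Equality of laws.  Since paths are continuous, a maximum is at most [y]
      as soon as the path is at most [y] at countably many dense times, so only
      probabilities of orthants have to be compared.  The Gaussian hypothesis
      gives the law of each linear combination of the values of the process,
      which is centred and hence determined by its second moment.  Two families
      with the same second moments then have the same expectations of cosines
      of linear combinations, and such expectations determine the probabilities
      of orthants: the indicator of a half-line is a bounded limit of
      polynomials in cosines ([orthant_prob], [gaussian_orthants]).

    - Finiteness.  The all-time maximum has moments of all orders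
      ([supremum_control], [peak_moment]).  This is dyadic chaining on each
      interval [[j, j + 1]], with the Gaussian estimate that
      [E |W_t - W_s|^(2N)] is a constant times [|t - s|^(2NH)].  Maxima over
      increments are replaced by sums of their [2N]-th powers; all these sums,
      suitably weighted, add up to one random variable of finite expectation
      which controls the whole path. *)

(** * Bounded integrals *)
Section bounded_integrals.
Context d (T : measurableType d) (R : realType) (P : probability T R).
Implicit Types f g : T -> R.

Lemma measurable_sublevel f (b : R) : measurable_fun setT f ->
  measurable [set w | f w <= b].
Proof.
move=> mf; have := mf measurableT _ (measurable_itv `]-oo, b]).
by rewrite setTI (_ : _ @^-1` _ = [set w | f w <= b]).
Qed.

Lemma bounded_integrable f (K : R) :
  measurable_fun setT f -> (forall w, `|f w| <= K) ->
  P.-integrable setT (EFin \o f).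
Proof.
move=> mf fK; apply: measurable_bounded_integrable => //.
  by rewrite -ge0_fin_numE ?fin_num_measure.
exists K; split; first exact: num_real.
by move=> y Ky w _ /=; rewrite (le_trans (fK w))// ltW.
Qed.

Lemma bounded_cvg_Rintegral (u : nat -> T -> R) f (K : R) :
  (forall k, measurable_fun setT (u k)) ->
  (forall k w, `|u k w| <= K) ->
  (forall w, u k w @[k --> \oo] --> f w) ->
  (\int[P]_w u k w) @[k --> \oo] --> \int[P]_w f w.
Proof.
move=> mu uK uf.
have mf : measurable_fun setT f by apply: measurable_realfun.measurable_fun_cvg mu _ => w _.
have fK w : `|f w| <= K.
  by apply: (cvgr_to_le (cvg_norm (uf w))); near=> k; exact: uK.
apply: fine_cvg; rewrite fineK; last first.
  by apply: integrable_fin_num => //; exact: bounded_integrable fK.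
apply: (@dominated_cvg _ T R P setT measurableT _ _ (EFin \o cst K)) => //.
- by move=> k; exact/measurable_EFinP.
- by move=> w _; apply: cvg_EFin (uf w); near=> k.
- by apply: (bounded_integrable (K := `|K|)).
- by move=> k w _; rewrite lee_fin.
Unshelve. all: by end_near. Qed.

Lemma measurable_cos_comp f : measurable_fun setT f ->
  measurable_fun setT (fun w => cos (f w)).
Proof.
move=> mf; apply: (measurableT_comp (f := cos : R -> R)) => //.
by apply: continuous_measurable_fun; exact: continuous_cos.
Qed.

End bounded_integrals.

(** * Polynomials close to a step function *)
Section step_polynomials.
Variable R : realType.
Implicit Types t z : R.

Lemma bernoulli_le (x : R) N : -1 <= x -> 1 + x *+ N <= (1 + x) ^+ N.
Proof.
move=> x1; elim: N => [|N IH]; first by rewrite mulr0n addr0 expr0.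
rewrite exprS mulrS (le_trans _ (ler_wpM2l _ IH))//; last lra.
have -> : (1 + x) * (1 + x *+ N) = 1 + (x + x *+ N) + x * x *+ N.
  by rewrite -(mulr_natr x) -(mulr_natr (x * x)); ring.
by rewrite lerDl mulrn_wge0// -expr2 sqr_ge0.
Qed.

Lemma cvg_natmul_expr z : 0 <= z < 1 -> (k%:R * z ^+ k) @[k --> \oo] --> (0 : R).
Proof.
move=> /andP[z0 z1]; have [->|zn0] := eqVneq z 0.
  apply: (@cvg_trans _ (cst 0 @ \oo)); last exact: cvg_cst.
  apply: near_eq_cvg; near=> k; rewrite /cst expr0n.
  by rewrite gtn_eqF ?mulr0//; near: k; exact: nbhs_infty_gt.
have zgt0 : 0 < z by rewrite lt_neqAle eq_sym zn0.
(* [k w^k] is bounded for [w = sqrt z < 1], by Bernoulli applied to [1/w] *)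
pose w := Num.sqrt z.
have w0 : 0 < w by rewrite sqrtr_gt0.
have w1 : w < 1 by rewrite -sqrtr1 ltr_sqrt.
have wz : w * w = z by rewrite -expr2 sqr_sqrtr.
have h0 : 0 < w^-1 - 1 by rewrite subr_gt0 invf_gt1.
have kw k : k%:R * w ^+ k <= (w^-1 - 1)^-1.
  have := @bernoulli_le (w^-1 - 1) k ltac:(lra).
  rewrite (_ : 1 + (w^-1 - 1) = w^-1) ?exprVn => [bk|]; last by rewrite addrC subrK.
  rewrite -[leRHS]mul1r ler_pdivlMr// mulrAC -ler_pdivlMr ?exprn_gt0// mul1r.
  by rewrite (le_trans _ bk)// mulr_natl lerDr.
apply: (squeeze_cvgr (f := cst 0) (h := fun k => (w^-1 - 1)^-1 * w ^+ k)).
- near=> k; rewrite mulr_ge0 ?exprn_ge0//=.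
  by rewrite -wz exprMn mulrA ler_wpM2r ?exprn_ge0// ltW.
- exact: cvg_cst.
- rewrite -[X in _ --> X](mulr0 (w^-1 - 1)^-1); apply: cvgMr.
  by apply: cvg_expr; rewrite ger0_norm ?ltW.
Unshelve. all: by end_near. Qed.

(** With [m = k 2^k] and [s = t^k], Bernoulli's inequality gives
    [(1 - s)^m >= 1 - m s = 1 - k (2t)^k] and
    [(1 - s)^m <= (1 + s)^(-m) <= 1 / (k (2t)^k)].  The first bound tends to 1
    when [t < 1/2], the second to 0 otherwise; the factor [k] is there for the
    case [t = 1/2]. *)
Lemma cvg_step t : 0 <= t <= 1 ->
  (1 - t ^+ k) ^+ (k * 2 ^ k) @[k --> \oo] --> ((t < 2^-1)%R%:R : R).
Proof.
move=> /andP[t0 t1].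
have tk k : 0 <= t ^+ k <= 1 by rewrite exprn_ge0// exprn_ile1.
have q0 k : 0 <= (1 - t ^+ k) ^+ (k * 2 ^ k).
  by rewrite exprn_ge0// subr_ge0; case/andP: (tk k).
have [t12|t12] := ltP t 2^-1.
  apply: (squeeze_cvgr (f := fun k => 1 - k%:R * (2 * t) ^+ k) (h := cst 1)).
  - near=> k; have /andP[tk0 tk1] := tk k; apply/andP; split; last first.
      by rewrite exprn_ile1//; lra.
    have := @bernoulli_le (- t ^+ k) (k * 2 ^ k) ltac:(lra).
    by rewrite mulNrn -(mulr_natl (t ^+ k)) natrM natrX exprMn mulrA.
  - rewrite -[X in _ --> X]subr0; apply: cvgB; first exact: cvg_cst.
    by apply: cvg_natmul_expr; lra.
  - exact: cvg_cst.
apply: (squeeze_cvgr (f := cst 0) (h := fun k => k%:R^-1)).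
- near=> k; have /andP[tk0 tk1] := tk k; rewrite q0/=.
  have k0 : (0 : R) < k%:R by rewrite ltr0n; near: k; exact: nbhs_infty_gt.
  rewrite -[leRHS]mul1r ler_pdivlMr//.
  have kb : k%:R <= (1 + t ^+ k) ^+ (k * 2 ^ k).
    have := @bernoulli_le (t ^+ k) (k * 2 ^ k) ltac:(lra).
    apply: le_trans; rewrite -(mulr_natl (t ^+ k)) natrM natrX -mulrA -exprMn.
    by rewrite (@le_trans _ _ (k%:R * (2 * t) ^+ k)) ?lerDr// ler_peMr// exprn_ege1//; lra.
  rewrite (le_trans (ler_wpM2l (q0 k) kb))// -exprMn -subr_sqr expr1n.
  by rewrite exprn_ile1// ?subr_ge0 ?exprn_ile1// lerBlDr lerDl sqr_ge0.
- exact: cvg_cst.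
- apply/(gtr0_cvgV0 (f := fun k => k%:R)); last exact: cvgr_idn.
  by near=> k; rewrite ltr0n; near: k; exact: nbhs_infty_gt.
Unshelve. all: by end_near. Qed.

End step_polynomials.

(** * A Cramer-Wold theorem for orthants *)
Lemma measurable_orthant d (T : measurableType d) (R : realType) (n : nat)
    (Z : 'I_n -> T -> R) (b : 'I_n -> R) :
  (forall i, measurable_fun setT (Z i)) ->
  measurable [set w | forall i, Z i w <= b i].
Proof.
move=> mZ; rewrite (_ : [set w | _] = \bigcap_i [set w | Z i w <= b i]).
  apply: fin_bigcap_measurable => // i _.
  exact: measurable_sublevel.
by apply/seteqP; split => w /= Zw; [move=> i _|move=> i]; exact: Zw.
Qed.

Section cramer_wold.
Context d (T : measurableType d) (R : realType) (P : probability T R) (n : nat).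
Variables X Y : 'I_n -> T -> R.
Hypothesis mX : forall i, measurable_fun setT (X i).
Hypothesis mY : forall i, measurable_fun setT (Y i).

(** All waves are tested at once because multiplying [f] by a cosine then only
    changes the wave: the class of such [f] is stable under that product. *)
Definition same_wave (f : ('I_n -> R) -> R) := forall (a : 'I_n -> R) (c : R),
  \int[P]_w (f (X^~ w) * cos (\sum_i a i * X i w + c)) =
  \int[P]_w (f (Y^~ w) * cos (\sum_i a i * Y i w + c)).

Definition test_fun (f : ('I_n -> R) -> R) :=
  [/\ exists K, forall x, `|f x| <= K,
      measurable_fun setT (fun w => f (X^~ w)),
      measurable_fun setT (fun w => f (Y^~ w)) & same_wave f].

(** The multipliers form an algebra stable under bounded pointwise limits, so
    from the cosines one reaches the indicators of half-lines. *)
Definition multiplier g := forall f, test_fun f -> test_fun (fun x => f x * g x).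

Lemma wave_integrable (f : ('I_n -> R) -> R) (Z : 'I_n -> T -> R) a c (K : R) :
  (forall i, measurable_fun setT (Z i)) -> (forall x, `|f x| <= K) ->
  measurable_fun setT (fun w => f (Z^~ w)) ->
  P.-integrable setT (fun w => (f (Z^~ w) * cos (\sum_i a i * Z i w + c))%:E).
Proof.
move=> mZ fK mf; apply: (@bounded_integrable _ _ _ _ (fun w => f _ * cos _) K).
  apply: measurable_funM => //; apply: measurable_cos_comp.
  apply: measurable_funD => //; apply: measurable_sum => i.
  exact: measurable_funM.
move=> w; rewrite normrM -[leRHS]mulr1 ler_pM//.
by rewrite ler_norml cos_geN1 cos_le1.
Qed.

Lemma test_funB f g : test_fun f -> test_fun g -> test_fun (fun x => f x - g x).
Proof.
move=> [[K fK] mfX mfY sf] [[L gL] mgX mgY sg]; split.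
- by exists (K + L) => x; rewrite (le_trans (ler_normB _ _))// lerD.
- exact: measurable_funB.
- exact: measurable_funB.
- move=> a c; under eq_Rintegral do rewrite mulrBl.
  under [in RHS]eq_Rintegral do rewrite mulrBl.
  rewrite !RintegralB ?sf ?sg//; by apply: wave_integrable; eassumption.
Qed.

Lemma test_funZ k f : test_fun f -> test_fun (fun x => k * f x).
Proof.
move=> [[K fK] mfX mfY sf]; split.
- by exists (`|k| * K) => x; rewrite normrM ler_pM.
- exact: measurable_funM.
- exact: measurable_funM.
- move=> a c; under eq_Rintegral do rewrite -mulrA.
  under [in RHS]eq_Rintegral do rewrite -mulrA.
  rewrite !RintegralZl ?sf//; by apply: wave_integrable; eassumption.
Qed.

Lemma test_fun_cos f i th c0 :
  test_fun f -> test_fun (fun x => f x * cos (th * x i + c0)).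
Proof.
move=> [[K fK] mfX mfY sf]; split.
- exists K => x; rewrite normrM -[leRHS]mulr1 ler_pM//.
  by rewrite ler_norml cos_geN1 cos_le1.
- apply: measurable_funM => //; apply: measurable_cos_comp.
  by apply: measurable_funD => //; exact: measurable_funM.
- apply: measurable_funM => //; apply: measurable_cos_comp.
  by apply: measurable_funD => //; exact: measurable_funM.
- move=> a c.
  (* product-to-sum formula, with the coefficient of [x i] shifted by [th] *)
  pose ap s j := a j + s * th *+ (j == i).
  have cosM (x : 'I_n -> R) : cos (th * x i + c0) * cos (\sum_j a j * x j + c) =
      2^-1 * cos (\sum_j ap 1 j * x j + (c + c0)) +
      2^-1 * cos (\sum_j ap (-1) j * x j + (c - c0)).
    have apE s : \sum_j ap s j * x j = \sum_j a j * x j + s * (th * x i).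
      under eq_bigr do rewrite mulrDl.
      rewrite big_split/=; congr (_ + _); rewrite (bigD1 i)//= eqxx mulr1n.
      by rewrite big1 ?addr0 ?mulrA// => j /negPf ->; rewrite mulr0n mul0r.
    rewrite !apE; set A := \sum_j _.
    have -> : A + 1 * (th * x i) + (c + c0) = (A + c) + (th * x i + c0) by ring.
    have -> : A + -1 * (th * x i) + (c - c0) = (A + c) - (th * x i + c0) by ring.
    by move: (A + c) (th * x i + c0) => u v; rewrite cosD cosB; field.
  have E (Z : 'I_n -> T -> R) : (forall i, measurable_fun setT (Z i)) ->
     measurable_fun setT (fun w => f (Z^~ w)) ->
     \int[P]_w (f (Z^~ w) * cos (th * Z i w + c0) *
        cos (\sum_i a i * Z i w + c)) =
     2^-1 * (\int[P]_w (f (Z^~ w) * cos (\sum_j ap 1 j * Z j w + (c + c0)))) +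
     2^-1 * (\int[P]_w (f (Z^~ w) * cos (\sum_j ap (-1) j * Z j w + (c - c0)))).
    move=> mZ mfZ; rewrite -!RintegralZl//; try by apply: wave_integrable; eassumption.
    rewrite -RintegralD//.
    - apply: eq_Rintegral => w _.
      by rewrite -mulrA (cosM (Z^~ w)) mulrDr; congr (_ + _); rewrite mulrCA.
    - under eq_fun do rewrite /= mulrA; apply: (@wave_integrable (fun x => 2^-1 * f x) Z _ _ (2^-1 * K)) => //.
        by move=> x; rewrite normrM ger0_norm// ler_wpM2l.
      exact: measurable_funM.
    - under eq_fun do rewrite /= mulrA; apply: (@wave_integrable (fun x => 2^-1 * f x) Z _ _ (2^-1 * K)) => //.
        by move=> x; rewrite normrM ger0_norm// ler_wpM2l.
      exact: measurable_funM.
  by rewrite !E// !sf.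
Qed.

Lemma multiplier1 : multiplier (fun=> 1).
Proof. by move=> f tf; under eq_fun do rewrite mulr1. Qed.

Lemma multiplierB g h : multiplier g -> multiplier h ->
  multiplier (fun x => g x - h x).
Proof.
move=> mg mh f tf; under eq_fun do rewrite mulrBr.
by apply: test_funB; [exact: mg|exact: mh].
Qed.

Lemma multiplierZ k g : multiplier g -> multiplier (fun x => k * g x).
Proof.
by move=> mg f tf; under eq_fun do rewrite mulrCA; apply/test_funZ/mg.
Qed.

Lemma multiplierM g h : multiplier g -> multiplier h ->
  multiplier (fun x => g x * h x).
Proof.
by move=> mg mh f tf; under eq_fun do rewrite mulrA; apply/mh/mg.
Qed.

Lemma multiplierX g k : multiplier g -> multiplier (fun x => g x ^+ k).
Proof.
move=> mg; elim: k => [|k IH]; first exact: multiplier1.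
by under eq_fun do rewrite exprS; exact: multiplierM.
Qed.

Lemma multiplier_cvg (g_ : nat -> ('I_n -> R) -> R) g (B : R) :
  (forall k, multiplier (g_ k)) -> (forall k x, `|g_ k x| <= B) ->
  (forall x, g_ k x @[k --> \oo] --> g x) -> multiplier g.
Proof.
move=> mg gB gg f tf.
have tfg k := mg k _ tf.
have [[K fK] mfX mfY sf] := tf.
have gBx x : `|g x| <= B.
  by apply: (cvgr_to_le (cvg_norm (gg x))); near=> k; exact: gB.
have K0 x : `|f x * g x| <= K * B by rewrite normrM ler_pM.
have mlim (Z : 'I_n -> T -> R) :
    (forall k, measurable_fun setT (fun w => f (Z^~ w) * g_ k (Z^~ w))) ->
    measurable_fun setT (fun w => f (Z^~ w) * g (Z^~ w)).
  move=> mfgk; apply: measurable_realfun.measurable_fun_cvg mfgk _ => w _.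
  by apply: cvgMr; exact: gg.
have mfgX := mlim X (fun k => let: And4 _ m _ _ := tfg k in m).
have mfgY := mlim Y (fun k => let: And4 _ _ m _ := tfg k in m).
split => //; first by exists (K * B).
move=> a c.
have lim (Z : 'I_n -> T -> R) : (forall i, measurable_fun setT (Z i)) ->
    (forall k, measurable_fun setT (fun w => f (Z^~ w) * g_ k (Z^~ w))) ->
    \int[P]_w (f (Z^~ w) * g_ k (Z^~ w) * cos (\sum_i a i * Z i w + c))
      @[k --> \oo] -->
    \int[P]_w (f (Z^~ w) * g (Z^~ w) * cos (\sum_i a i * Z i w + c)).
  move=> mZ mfg; apply: (@bounded_cvg_Rintegral _ _ _ _ _ _ (K * B)).
  - move=> k; apply: measurable_funM => //; apply: measurable_cos_comp.
    apply: measurable_funD => //; apply: measurable_sum => i.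
    exact: measurable_funM.
  - move=> k w; rewrite normrM -[leRHS]mulr1 ler_pM// ?normrM ?ler_pM//.
    by rewrite ler_norml cos_geN1 cos_le1.
  - by move=> w; apply: cvgMl; apply: cvgMr; exact: gg.
have limX := lim X mX (fun k => let: And4 _ m _ _ := tfg k in m).
have limY := lim Y mY (fun k => let: And4 _ _ m _ := tfg k in m).
have XYk : (fun k => \int[P]_w (f (X^~ w) * g_ k (X^~ w) *
                     cos (\sum_i a i * X i w + c))) =
    (fun k => \int[P]_w (f (Y^~ w) * g_ k (Y^~ w) *
                     cos (\sum_i a i * Y i w + c))).
  by apply/funext => k; have [_ _ _ ->] := tfg k.
rewrite XYk in limX; exact: cvg_unique limX limY.
Unshelve. all: by end_near. Qed.

(** For small [th > 0] the sign of [sin (th (x i - b))] is that of [x i - b].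
    For each fixed [th], the step polynomials turn this sine, which is a shifted
    cosine, into the indicator of its sign; then [th] tends to 0. *)
Lemma multiplier_half_line i (b : R) :
  multiplier (fun x : 'I_n -> R => (x i <= b)%R%:R).
Proof.
pose t m (x : 'I_n -> R) := 2^-1 * (1 - sin (m.+1%:R^-1 * (x i - b))).
have tE m x : t m x = 2^-1 * (1 - (-1) *
    cos (m.+1%:R^-1 * x i + (- (m.+1%:R^-1 * b) + pi / 2))).
  by rewrite addrA cosDpihalf -mulrBr mulN1r opprK.
have t01 m x : 0 <= t m x <= 1.
  have := sin_geN1 (m.+1%:R^-1 * (x i - b)).
  have := sin_le1 (m.+1%:R^-1 * (x i - b)).
  rewrite /t; lra.
have mt m : multiplier (t m).
  rewrite (funext (tE m)); apply/multiplierZ/multiplierB.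
    exact: multiplier1.
  by apply: (@multiplierZ (-1)) => f tf; exact: test_fun_cos.
have mstep m : multiplier (fun x => (t m x < 2^-1)%R%:R).
  apply: (@multiplier_cvg (fun k x => (1 - t m x ^+ k) ^+ (k * 2 ^ k)) _ 1).
  - move=> k; apply: multiplierX; apply: multiplierB; first exact: multiplier1.
    exact: multiplierX.
  - move=> k x; have /andP[t0 t1] := t01 m x.
    have ? : t m x ^+ k <= 1 by rewrite exprn_ile1.
    have ? : 0 <= t m x ^+ k by rewrite exprn_ge0.
    by rewrite ger0_norm ?exprn_ge0 ?exprn_ile1//; lra.
  - by move=> x; exact: cvg_step.
suff : multiplier (fun x => 1 - (b < x i)%R%:R).
  rewrite (_ : (fun x => _) = (fun x => (x i <= b)%R%:R))//.
  by apply/funext => x; case: ltP => _; rewrite ?subrr ?subr0.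
apply: multiplierB; first exact: multiplier1.
apply: (@multiplier_cvg (fun m x => (t m x < 2^-1)%R%:R) _ 1) => //.
  by move=> k x; rewrite normr_nat lern1 leq_b1.
move=> x; apply: (@cvg_trans _ (cst (b < x i)%R%:R @ \oo)); last exact: cvg_cst.
apply: near_eq_cvg; near=> m; rewrite /cst.
have m0 : (0 : R) < m.+1%:R^-1 by rewrite invr_gt0.
have mx : `|x i - b| < m.+1%:R.
  rewrite (@lt_trans _ _ m%:R) ?ltr_nat//.
  by near: m; exact: nbhs_infty_gtr.
have {}mx : m.+1%:R^-1 * `|x i - b| < 1 by rewrite mulrC ltr_pdivrMr ?mul1r.
set y := m.+1%:R^-1 * (x i - b).
suff -> : (b < x i) = (0 < sin y).
  by congr ((_ : bool)%:R); rewrite /t -/y; apply/idP/idP => ?; lra.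
have [bx|bx|bx] := ltgtP b (x i).
- apply/esym/sin2_gt0; rewrite mulr_gt0 ?subr_gt0//=.
  by move: mx; rewrite gtr0_norm ?subr_gt0// -/y; lra.
- have : 0 < sin (- y).
    apply/sin2_gt0; rewrite oppr_gt0 pmulr_rlt0// subr_lt0 bx/=.
    by move: mx; rewrite ltr0_norm ?subr_lt0// mulrN -/y; lra.
  by rewrite sinN => ?; apply/esym/negbTE; rewrite -leNgt; lra.
- by rewrite /y bx subrr mulr0 sin0 ltxx.
Unshelve. all: by end_near. Qed.

Hypothesis XY_wave : forall (a : 'I_n -> R) (c : R),
  \int[P]_w cos (\sum_i a i * X i w + c) =
  \int[P]_w cos (\sum_i a i * Y i w + c).

(** The indicator of the orthant is a product of indicators of half-lines,
    hence a test function; take the constant wave. *)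
Lemma orthant_prob (b : 'I_n -> R) :
  P [set w | forall i, X i w <= b i] = P [set w | forall i, Y i w <= b i].
Proof.
pose F (s : seq 'I_n) (x : 'I_n -> R) : R := \prod_(i <- s) (x i <= b i)%R%:R.
have tF s : test_fun (F s).
  elim: s => [|i s IH].
    rewrite (_ : F [::] = fun=> 1); last by apply/funext => x; rewrite /F big_nil.
    split => //; first by exists 1 => x; rewrite normr1.
    by move=> a c; under eq_Rintegral do rewrite mul1r;
       under [in RHS]eq_Rintegral do rewrite mul1r.
  rewrite (_ : F (i :: s) = fun x => F s x * (x i <= b i)%R%:R).
    exact: multiplier_half_line.
  by apply/funext => x; rewrite /F big_cons mulrC.
have FE x : F (enum 'I_n) x = \1_[set x : 'I_n -> R | forall i, x i <= b i] x.
  rewrite indicE; case: (pselect (forall i, x i <= b i)) => xb.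
    by rewrite mem_set// /F big1// => i _; rewrite xb.
  rewrite memNset// /F; have /existsNP[i /negP/negbTE xi] := xb.
  by rewrite (bigD1_seq i) ?mem_enum ?enum_uniq//= xi mul0r.
have intF (Z : 'I_n -> T -> R) : (forall i, measurable_fun setT (Z i)) ->
    \int[P]_w (F (enum 'I_n) (Z^~ w) * cos (\sum_i 0 * Z i w + 0)) =
    fine (P [set w | forall i, Z i w <= b i]).
  move=> mZ; rewrite -[in RHS](setIT [set w | _]) -integral_indic//; last first.
    exact: measurable_orthant.
  apply: eq_Rintegral => w _; rewrite FE big1 ?add0r ?cos0 ?mulr1; last by move=> i; rewrite mul0r.
  by [].
have [_ _ _ /(_ (fun=> 0) 0)] := tF (enum 'I_n); rewrite !intF//.
have finP (Z : 'I_n -> T -> R) : (forall i, measurable_fun setT (Z i)) ->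
    P [set w | forall i, Z i w <= b i] \is a fin_num.
  by move=> mZ; apply: fin_num_measure; exact: measurable_orthant.
by move=> PXY; rewrite -(fineK (finP _ mX)) PXY (fineK (finP _ mY)).
Qed.

End cramer_wold.

(** * Expectations under normal laws *)
Section normal_expectation.
Variable R : realType.
Local Notation mu := (@lebesgue_measure R).
Implicit Types (m s : R) (g : R -> R).
Local Open Scope ereal_scope.

(** The Radon-Nikodym derivative of the normal law is almost everywhere its
    density, both having the same integral on every measurable set. *)
Lemma bounded_integral_normal_prob m s g (K : R) : measurable_fun setT g ->
  (forall x, `|g x| <= K)%R ->
  \int[normal_prob m s]_x (g x)%:E = \int[mu]_x (g x * normal_pdf m s x)%:E.
Proof.
move=> mg gK.
rewrite -(Radon_Nikodym_change_of_variables (normal_prob_dominates m s))//=; last first.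
  exact: (@bounded_integrable _ _ _ (normal_prob m s) _ _ mg gK).
under [RHS]eq_integral do rewrite EFinM.
apply: ae_eq_integral => //.
- apply: emeasurable_funM; first exact/measurable_EFinP.
  apply: (measurable_int mu).
  by apply: Radon_Nikodym_integrable; exact: normal_prob_dominates.
- apply: emeasurable_funM; first exact/measurable_EFinP.
  by apply/measurable_EFinP; exact: measurable_normal_pdf.
- apply: ae_eqe_mul2l => /=.
  rewrite Radon_NikodymE//=; first exact: normal_prob_dominates.
  move=> nmu; case: cid => /= h [h1 h2 h3].
  apply: integral_ae_eq => //=.
  + by apply/measurable_EFinP; exact: measurable_normal_pdf.
  + by move=> E E01 mE; rewrite -h3.
Qed.

(** Truncation at [n] and monotone convergence reduce this to the bounded
    case. *)
Lemma ge0_integral_normal_prob m s g : measurable_fun setT g ->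
  (forall x, 0 <= g x)%R ->
  \int[normal_prob m s]_x (g x)%:E = \int[mu]_x (g x * normal_pdf m s x)%:E.
Proof.
move=> mg g0.
pose gn n x := Num.min (g x) n%:R.
have mgn n : measurable_fun setT (gn n) by apply: measurable_minr.
have gn0 n x : (0 <= gn n x)%R by rewrite le_min g0/=.
have gnn n x : (`|gn n x| <= n%:R)%R by rewrite ger0_norm// ge_min lexx orbT.
have ndgn x i j : (i <= j)%N -> (gn i x <= gn j x)%R.
  by move=> ij; rewrite le_min !ge_min lexx/= ler_nat ij orbT.
have gng x : (gn n x)%:E @[n --> \oo] --> (g x)%:E.
  apply: cvg_near_cst; near=> n; congr EFin; apply/min_idPl.
  by near: n; exact: nbhs_infty_ger.
have gngp x : (gn n x * normal_pdf m s x)%:E @[n --> \oo] -->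
    (g x * normal_pdf m s x)%:E.
  apply: cvg_near_cst; near=> n; congr (_ * _)%:E; apply/min_idPl.
  by near: n; exact: nbhs_infty_ger.
have : \int[normal_prob m s]_x (gn n x)%:E @[n --> \oo] -->
       \int[normal_prob m s]_x (g x)%:E.
  have -> : \int[normal_prob m s]_x (g x)%:E =
      \int[normal_prob m s]_x limn (fun n => (gn n x)%:E).
    by apply: eq_integral => x _; rewrite (cvg_lim _ (gng x)).
  apply: cvg_monotone_convergence => //.
  - by move=> n; apply/measurable_EFinP; exact: mgn.
  - by move=> n x _; rewrite lee_fin.
  - by move=> x _ i j ij; rewrite lee_fin; exact: ndgn.
have : \int[mu]_x (gn n x * normal_pdf m s x)%:E @[n --> \oo] -->
       \int[mu]_x (g x * normal_pdf m s x)%:E.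
  have -> : \int[mu]_x (g x * normal_pdf m s x)%:E =
      \int[mu]_x limn (fun n => (gn n x * normal_pdf m s x)%:E).
    by apply: eq_integral => x _; rewrite (cvg_lim _ (gngp x)).
  apply: cvg_monotone_convergence => //.
  - move=> n; apply/measurable_EFinP; apply: measurable_funM; first exact: mgn.
    exact: measurable_normal_pdf.
  - by move=> n x _; rewrite lee_fin mulr_ge0// normal_pdf_ge0.
  - move=> x _ i j ij; rewrite lee_fin ler_wpM2r ?normal_pdf_ge0//; exact: ndgn.
move=> lim1 lim2.
have intE : (fun n => \int[normal_prob m s]_x (gn n x)%:E) =
            (fun n => \int[mu]_x (gn n x * normal_pdf m s x)%:E).
  by apply/funext => n; exact: bounded_integral_normal_prob (gnn n).
by rewrite intE in lim2; exact: cvg_unique lim2 lim1.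
Unshelve. all: by end_near. Qed.

Lemma normal_prob_affine m s g : (0 < s)%R -> continuous g ->
  (forall x, 0 <= g x)%R ->
  \int[normal_prob m s]_x (g x)%:E =
  \int[normal_prob 0 1]_z (g (m + s * z)%R)%:E.
Proof.
move=> s0 cg g0.
pose F z : R := (m + s * z)%R.
have dF (x : R) : is_derive x (1 : R)%R (F : R -> R) s.
  rewrite /F; apply: is_derive_eq.
  by rewrite add0r mul1r [LHS]mulr1.
have F' : (F^`())%classic = cst s.
  by apply/funext => x; rewrite derive1E derive_val.
have cF : continuous F.
  by move=> x; apply/differentiable_continuous/derivable1_diffP.
have mg : measurable_fun setT g by exact: continuous_measurable_fun.
have mgF : measurable_fun setT (fun z => g (F z)).
  apply: continuous_measurable_fun => x.
  by apply: continuous_comp; [exact: cF|exact: cg].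
rewrite (ge0_integral_normal_prob _ _ mg g0).
rewrite (ge0_integral_normal_prob 0 1 mgF (fun z => g0 (F z))).
rewrite (@increasing_ge0_integration_by_substitutionT _ F)/=.
- apply: eq_integral => z _; congr EFin.
  rewrite F' !fctE -/(F z) -mulrA; congr (_ * _)%R.
  rewrite !normal_pdfE ?gt_eqF// /normal_fun /normal_peak.
  rewrite mulrAC; congr (_ * expR _)%R.
    rewrite expr1n mul1r -mulrnAr sqrtrM ?sqr_ge0// sqrtr_sqr gtr0_norm//.
    by rewrite invfM mulrAC mulVf ?mul1r// gt_eqF.
  rewrite /F addrC addKr subr0 expr1n exprMn -[(s ^+ 2 *+ 2)%R]mulr_natr.
  rewrite -mulrN -mulf_div divff ?mul1r// sqrf_eq0 gt_eqF//.
- by move=> x y xy; rewrite /F ltrD2l ltr_pM2l.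
- by rewrite F' => ?; exact: cvg_cst.
- by rewrite F'; exact: is_cvg_cst.
- by rewrite F'; exact: is_cvg_cst.
- by move=> x.
- apply: (cvg_comp (fun z => s * z)%R (fun z => m + z)%R); last exact: cvg_addrl_Ny.
  by apply/gt0_cvgMrNy.
- apply: (cvg_comp (fun z => s * z)%R (fun z => m + z)%R); last exact: cvg_addrl.
  by apply/gt0_cvgMry.
- move=> x; apply: cvgM; first exact: cg.
  by apply: continuous_normal_pdf; rewrite gt_eqF.
- by move=> x; rewrite mulr_ge0// normal_pdf_ge0.
Qed.

End normal_expectation.

(** * The standard normal law and Gaussian variables *)
Section standard_normal.
Variable R : realType.
Local Notation std := (@normal_prob R 0 1).

Lemma sqr_power_le_expR (y : R) N : y ^+ (2 * N) <= N`!%:R * expR (y ^+ 2).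
Proof.
rewrite exprM mulrC -ler_pdivrMr ?ltr0n ?fact_gt0//.
case: N => [|N].
  by rewrite expr0 fact0 divr1 -[leLHS]expR0 ler_expR sqr_ge0.
apply: le_trans (expR_ge1Dxn N (sqr_ge0 y)).
by rewrite lerDr.
Qed.

Lemma std_setT : std setT = 1%E.
Proof. exact: integral_normal_pdf. Qed.

(** The polynomial is at most a constant times [exp (z^2 / 4)], which turns the
    density of variance 1 into a multiple of the density of variance 2. *)
Lemma std_moment_lty N (a : R) :
  (\int[std]_z ((z - a) ^+ (2 * N))%:E < +oo)%E.
Proof.
have even_ge0 (y : R) : 0 <= y ^+ (2 * N) by rewrite exprM exprn_ge0 ?sqr_ge0.
rewrite ge0_integral_normal_prob//; last first.
  by apply: measurable_funX; exact: measurable_funB.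
pose s : R := Num.sqrt 2.
have s0 : 0 < s by rewrite sqrtr_gt0.
have s2 : s ^+ 2 = 2 by rewrite sqr_sqrtr.
pose K : R := 8 ^+ N * N`!%:R * expR (a ^+ 2 / 4) * (normal_peak 1 / normal_peak s).
have peak0 (r : R) : r != 0 -> 0 < normal_peak r by exact: normal_peak_gt0.
have K0 : 0 <= K.
  by rewrite /K !mulr_ge0 ?expR_ge0 ?exprn_ge0 ?invr_ge0 ?normal_peak_ge0 ?ler0n.
apply: (@le_lt_trans _ _ (\int[lebesgue_measure]_z (K%:E * (normal_pdf 0 s z)%:E)))%E.
  apply: ge0_le_integral => //=.
  - by move=> z _; rewrite lee_fin mulr_ge0// normal_pdf_ge0.
  - apply/measurable_EFinP; apply: measurable_funM; last exact: measurable_normal_pdf.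
    by apply: measurable_funX; exact: measurable_funB.
  - apply/measurable_EFinP; apply: measurable_funM => //.
    exact: measurable_normal_pdf.
  - move=> z _; rewrite -EFinM lee_fin !normal_pdfE ?gt_eqF// /normal_fun !subr0 s2.
    rewrite expr1n.
    have -> : K * (normal_peak s * expR (- z ^+ 2 / (2 *+ 2))) =
        8 ^+ N * N`!%:R * (expR (a ^+ 2 / 4) * expR (- z ^+ 2 / 4)) * normal_peak 1.
      rewrite /K -[2 *+ 2]mulr_natr -natrM; field.
      by rewrite gt_eqF// peak0// gt_eqF.
    rewrite [leLHS]mulrCA [leLHS]mulrC ler_wpM2r ?normal_peak_ge0//.
    (* (z - a)^2 <= 2 z^2 + 2 a^2 *)
    pose y := (z - a) / Num.sqrt 8.
    have y2 : y ^+ 2 = (z - a) ^+ 2 / 8 by rewrite exprMn exprVn sqr_sqrtr.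
    have -> : (z - a) ^+ (2 * N) = 8 ^+ N * y ^+ (2 * N).
      by rewrite !exprM y2 expr_div_n mulrCA divff ?mulr1// expf_neq0.
    rewrite -!mulrA ler_wpM2l ?exprn_ge0//.
    apply: (@le_trans _ _ (N`!%:R * expR (y ^+ 2) * expR (- z ^+ 2 / 2))).
      by rewrite ler_wpM2r ?expR_ge0// sqr_power_le_expR.
    rewrite -mulrA ler_wpM2l// -!expRD ler_expR y2.
    have := sqr_ge0 (z + a); lra.
rewrite ge0_integralZl//.
- by rewrite integral_normal_pdf mule1 ltry.
- by apply/measurable_EFinP; exact: measurable_normal_pdf.
- by move=> z _; rewrite lee_fin normal_pdf_ge0.
Qed.

Definition std_mean : R := \int[std]_z z.

(** The moments are centred at [std_mean], so that they are the moments of a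
    centred Gaussian variable whatever the value of [std_mean]. *)
Definition std_moment N : R := \int[std]_z ((z - std_mean) ^+ (2 * N)).

Lemma std_momentE N :
  (\int[std]_z ((z - std_mean) ^+ (2 * N))%:E)%E = (std_moment N)%:E.
Proof.
rewrite /std_moment /Rintegral fineK// ge0_fin_numE ?std_moment_lty//.
by apply: integral_ge0 => z _; rewrite lee_fin exprM exprn_ge0 ?sqr_ge0.
Qed.

Lemma std_moment_ge0 N : 0 <= std_moment N.
Proof. by apply: Rintegral_ge0 => z _; rewrite exprM exprn_ge0 ?sqr_ge0. Qed.

Lemma std_integrable : std.-integrable setT (EFin \o idfun).
Proof.
apply: (@le_integrable _ _ _ std setT measurableT (EFin \o idfun) (EFin \o (fun z : R => 1 + (z - 0) ^+ (2 * 1)))).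
- by apply/measurable_EFinP; exact: measurable_id.
- move=> z _; rewrite /= lee_fin subr0 muln1 [leRHS]ger0_norm ?addr_ge0 ?sqr_ge0//.
  rewrite -real_normK ?num_real//.
  have := sqr_ge0 (`|z| - 1/2); have := normr_ge0 z; lra.
- have mf : measurable_fun setT (fun z : R => 1 + (z - 0) ^+ (2 * 1)).
    by apply: measurable_funD => //; apply: measurable_funX; exact: measurable_funB.
  apply/integrableP; split; first exact/measurable_EFinP.
  under eq_integral do rewrite /= muln1 ger0_norm ?addr_ge0 ?sqr_ge0// EFinD.
  rewrite ge0_integralD//.
  + rewrite integral_cst// mul1e [X in (X + _)%E](std_setT).
    by rewrite lte_add_pinfty ?ltry//; exact: (std_moment_lty 1 0).
  + by move=> z _; rewrite lee_fin sqr_ge0.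
  + by apply/measurable_EFinP; apply: measurable_funX; exact: measurable_funB.
Qed.

(** If it were 0, the standard normal law would be concentrated at its mean,
    but points are null for it. *)
Lemma std_moment1_gt0 : 0 < std_moment 1.
Proof.
rewrite lt_neqAle std_moment_ge0 andbT eq_sym; apply/eqP => c0.
have := std_momentE 1; rewrite c0 => int0.
have mf : measurable_fun setT (fun z : R => (z - std_mean) ^+ (2 * 1)).
  by apply: measurable_funX; exact: measurable_funB.
have : ae_eq std setT (fun z : R => ((z - std_mean) ^+ (2 * 1))%:E) (cst 0%E).
  apply/ae_eq_integral_abs => //; first exact/measurable_EFinP.
  apply: etrans int0; apply: eq_integral => z _.
  by rewrite gee0_abs// lee_fin exprM exprn_ge0 ?sqr_ge0.
move=> [A [mA A0 subA]].
have : std setT = 0%E; last by rewrite std_setT => /eqP; rewrite onee_eq0.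
have point0 : std [set std_mean] = 0%E.
  have := normal_prob_dominates (0 : R) 1 => /null_content_dominatesP; apply => //.
  exact: lebesgue_measure_set1.
rewrite (_ : setT = A `|` [set std_mean]); last first.
  apply/seteqP; split => // z _; case: (pselect (z = std_mean)) => [->|zn]; [by right|left].
  apply: subA => /= /(_ I) -[] /eqP; rewrite expf_eq0/= subr_eq0 => /eqP; exact: zn.
apply: null_set_setU => //.
Qed.

End standard_normal.

Lemma ge0_expectation_law d (Omega : measurableType d) (R : realType)
    (P : probability Omega R) (nu : {measure set (measurableTypeR R) -> \bar R})
    (Y : Omega -> R) (g : R -> R) :
  measurable_fun setT Y -> measurable_fun setT g -> (forall x, 0 <= g x) ->
  (forall A : set (measurableTypeR R), measurable A -> P (Y @^-1` A) = nu A) ->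
  (\int[P]_w (g (Y w))%:E = \int[nu]_x (g x)%:E)%E.
Proof.
move=> mY mg g0 law.
rewrite -(@ge0_integral_pushforward _ _ Omega (measurableTypeR R) R Y mY P setT
  (fun x => (g x)%:E))//=.
- by apply: eq_measure_integral => A mA _; rewrite -law.
- exact/measurable_EFinP.
- by move=> x _; rewrite lee_fin.
Qed.

Section gaussian_variable.
Context d (Omega : measurableType d) (R : realType) (P : probability Omega R).
Local Notation std := (@normal_prob R 0 1).
Variable Y : Omega -> R.
Hypothesis mY : measurable_fun setT Y.
Variables m s : R.
Hypothesis s0 : 0 <= s.
Hypothesis lawY : forall A : set (measurableTypeR R), measurable A ->
  pushforward P Y A = gaussian_law m s A.

(** This form covers the degenerate case [s = 0] as well, so that below no
    distinction has to be made. *)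
Lemma gaussian_expectation (g : R -> R) : continuous g -> (forall x, 0 <= g x) ->
  (\int[P]_w (g (Y w))%:E = \int[std]_z (g (m + s * z))%:E)%E.
Proof.
move=> cg g0.
have mg : measurable_fun setT g by exact: continuous_measurable_fun.
have [sE|sn0] := eqVneq s 0.
  rewrite (ge0_expectation_law (nu := dirac (m : measurableTypeR R)) mY)//; last first.
    by move=> A mA; apply: (etrans (lawY mA)); rewrite /gaussian_law sE eqxx.
  rewrite integral_dirac//; last exact/measurable_EFinP.
  rewrite diracT mul1e/= sE; under eq_integral do rewrite mul0r addr0.
  by rewrite integral_cst// [X in (_ * X)%E](std_setT R) mule1.
have lawN (A : set (measurableTypeR R)) : measurable A ->
    P (Y @^-1` A) = normal_prob m s A.
  by move=> mA; apply: (etrans (lawY mA)); rewrite /gaussian_law (negbTE sn0).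
rewrite (@ge0_expectation_law _ _ _ P (normal_prob m s) Y g mY mg g0 lawN).
by apply: normal_prob_affine => //; rewrite lt_neqAle eq_sym sn0.
Qed.

Hypothesis EY : ('E_P[Y] = 0)%E.

(** A centred Gaussian variable has one free parameter [s], which its second
    moment determines. *)
Lemma centered_gaussian_mean : m = - s * std_mean R.
Proof.
have intz : std.-integrable setT (EFin \o (fun z : R => m + s * z)).
  have := @std_integrable R.
  move=> iz; apply: (@integrableD _ _ _ std setT measurableT (fun=> m%:E) (fun z => (s * z)%:E)).
    exact: (@bounded_integrable _ _ _ std (cst m) `|m|).
  by under eq_fun do rewrite EFinM; apply: integrableZl.
have : ('E_P[Y] = \int[std]_z (m + s * z)%:E)%E.
  rewrite unlock integralE [RHS]integralE; congr (_ - _)%E.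
    rewrite (eq_integral (fun w => (Num.max (Y w) 0)%:E)); last first.
      by move=> w _; rewrite funeposE EFin_max.
    rewrite (@gaussian_expectation (fun y => Num.max y 0)).
    - by apply: eq_integral => z _; rewrite funeposE EFin_max.
    - by move=> x; apply: continuous_max; [exact: cvg_id|exact: cvg_cst].
    - by move=> x; rewrite le_max lexx orbT.
  rewrite (eq_integral (fun w => (Num.max (- Y w) 0)%:E)); last first.
    by move=> w _; rewrite funenegE EFin_max.
  rewrite (@gaussian_expectation (fun y => Num.max (- y) 0)).
  - by apply: eq_integral => z _; rewrite funenegE EFin_max.
  - by move=> x; apply: continuous_max; [apply: cvgN; exact: cvg_id|exact: cvg_cst].
  - by move=> x; rewrite le_max lexx orbT.
rewrite EY => EYE.
have : (0 : R) = \int[std]_z (m + s * z) by rewrite /Rintegral -EYE.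
rewrite RintegralD//; last 2 first.
- exact: (@bounded_integrable _ _ _ std (cst m) `|m|).
- exact: (integrableZl measurableT s (@std_integrable R)).
rewrite RintegralZl//; last exact: std_integrable.
rewrite Rintegral_cst// [X in fine X](std_setT R) mulr1 -/(std_mean R); lra.
Qed.

Lemma centered_gaussian_moment N :
  (\int[P]_w (Y w ^+ (2 * N))%:E = (s ^+ (2 * N) * std_moment R N)%:E)%E.
Proof.
rewrite (@gaussian_expectation (fun y => y ^+ (2 * N))).
- rewrite centered_gaussian_mean EFinM -std_momentE -ge0_integralZl//.
  + by apply: eq_integral => z _; rewrite -EFinM -exprMn; congr (_ ^+ _)%:E; ring.
  + by apply/measurable_EFinP; apply: measurable_funX; exact: measurable_funB.
  + by move=> z _; rewrite lee_fin exprM exprn_ge0 ?sqr_ge0.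
  + by rewrite lee_fin exprn_ge0.
- exact: exprn_continuous.
- by move=> x; rewrite exprM exprn_ge0 ?sqr_ge0.
Qed.

End gaussian_variable.

(** * Square integrable variables *)
Section square_integrable.
Context d (Omega : measurableType d) (R : realType) (P : probability Omega R).
Implicit Types f g : Omega -> R.

Definition square_integrable f :=
  measurable_fun setT f /\ P.-integrable setT (fun w => (f w ^+ 2)%:E).

Definition inner f g : R := \int[P]_w (f w * g w).

Lemma square_integrableM f g : square_integrable f -> square_integrable g ->
  P.-integrable setT (fun w => (f w * g w)%:E).
Proof.
move=> [mf if2] [mg ig2].
apply: (le_integrable measurableT (g := fun w => (f w ^+ 2 + g w ^+ 2)%:E)).
- by apply/measurable_EFinP; exact: measurable_funM.
- move=> w _; rewrite /= lee_fin [leRHS]ger0_norm ?addr_ge0 ?sqr_ge0// normrM.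
  rewrite -(real_normK (num_real (f w))) -(real_normK (num_real (g w))).
  have := sqr_ge0 (`|f w| - `|g w|); have := sqr_ge0 (`|f w|).
  have := sqr_ge0 (`|g w|); lra.
- exact: (integrableD measurableT if2 ig2).
Qed.

Lemma square_integrableZ k f : square_integrable f ->
  square_integrable (fun w => k * f w).
Proof.
move=> [mf if2]; split; first exact: measurable_funM.
by under eq_fun do rewrite exprMn EFinM; exact: integrableZl.
Qed.

Lemma square_integrableD f g : square_integrable f -> square_integrable g ->
  square_integrable (fun w => f w + g w).
Proof.
move=> sf sg; have [mf if2] := sf; have [mg ig2] := sg.
split; first exact: measurable_funD.
apply: (@eq_integrable _ _ _ P setT measurableT
   ((fun w => (f w ^+ 2)%:E) \+ (fun w => (g w ^+ 2)%:E)
     \+ (fun w => 2%:E * (f w * g w)%:E))%E).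
  by move=> w _ /=; rewrite -EFinM -!EFinD; congr EFin; ring.
apply: integrableD => //; first exact: integrableD.
by apply: integrableZl => //; exact: square_integrableM.
Qed.

Lemma square_integrable_cst k : square_integrable (cst k).
Proof.
split; first exact: measurable_cst.
exact: (@bounded_integrable _ _ _ _ (fun=> k ^+ 2) `|k ^+ 2|).
Qed.

Lemma square_integrable_integrable f : square_integrable f ->
  P.-integrable setT (fun w => (f w)%:E).
Proof.
move=> sf; under eq_fun do rewrite -[f _]mulr1.
exact: (square_integrableM sf (square_integrable_cst 1)).
Qed.

Lemma innerC f g : inner f g = inner g f.
Proof. by apply: eq_Rintegral => w _; rewrite mulrC. Qed.

Lemma innerDl f f' g : square_integrable f -> square_integrable f' ->
  square_integrable g ->
  inner (fun w => f w + f' w) g = inner f g + inner f' g.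
Proof.
move=> sf sf' sg; rewrite /inner; under eq_Rintegral do rewrite mulrDl.
by rewrite RintegralD//; exact: square_integrableM.
Qed.

Lemma innerZl k f g : square_integrable f -> square_integrable g ->
  inner (fun w => k * f w) g = k * inner f g.
Proof.
move=> sf sg; rewrite /inner; under eq_Rintegral do rewrite -mulrA.
by rewrite RintegralZl//; exact: square_integrableM.
Qed.

Lemma innerBl f f' g : square_integrable f -> square_integrable f' ->
  square_integrable g ->
  inner (fun w => f w - f' w) g = inner f g - inner f' g.
Proof.
move=> sf sf' sg; rewrite /inner; under eq_Rintegral do rewrite mulrBl.
by rewrite RintegralB//; exact: square_integrableM.
Qed.

Lemma innerBr f g g' : square_integrable f -> square_integrable g ->
  square_integrable g' ->
  inner f (fun w => g w - g' w) = inner f g - inner f g'.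
Proof. by move=> sf sg sg'; rewrite innerC innerBl// !(innerC f). Qed.

Lemma square_integrable_sum n (a : 'I_n -> R) (X : 'I_n -> Omega -> R) :
  (forall i, square_integrable (X i)) ->
  square_integrable (fun w => \sum_i a i * X i w).
Proof.
move=> sX; elim: (index_enum _) => [|i s IH].
  by under eq_fun do rewrite big_nil; exact: square_integrable_cst.
under eq_fun do rewrite big_cons.
by apply: square_integrableD => //; exact: square_integrableZ.
Qed.

Lemma inner_suml n (a : 'I_n -> R) (X : 'I_n -> Omega -> R) g :
  (forall i, square_integrable (X i)) -> square_integrable g ->
  inner (fun w => \sum_i a i * X i w) g = \sum_i a i * inner (X i) g.
Proof.
move=> sX sg.
suff : square_integrable (fun w => \sum_i a i * X i w) /\
   inner (fun w => \sum_i a i * X i w) g = \sum_i a i * inner (X i) g by case.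
elim: (index_enum _) => [|i s [IH1 IH2]].
  under eq_fun do rewrite big_nil; rewrite big_nil; split.
    exact: square_integrable_cst.
  by rewrite /inner; under eq_Rintegral do rewrite mul0r; rewrite Rintegral_cst// mul0r.
under eq_fun do rewrite big_cons; rewrite big_cons; split.
  by apply: square_integrableD => //; exact: square_integrableZ.
by rewrite innerDl ?innerZl ?IH2//; exact: square_integrableZ.
Qed.

Lemma inner_sum_sum n (a : 'I_n -> R) (X : 'I_n -> Omega -> R) :
  (forall i, square_integrable (X i)) ->
  inner (fun w => \sum_i a i * X i w) (fun w => \sum_i a i * X i w) =
  \sum_i \sum_j a i * a j * inner (X i) (X j).
Proof.
move=> sX; rewrite inner_suml//; last exact: square_integrable_sum.
apply: eq_bigr => i _; rewrite innerC inner_suml// mulr_sumr.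
by apply: eq_bigr => j _; rewrite mulrA innerC.
Qed.

End square_integrable.

(** * Equality of laws *)
Section equal_laws.
Context d (Omega : measurableType d) (R : realType) (P : probability Omega R).

Definition same_law (Y Z : Omega -> R) :=
  forall A : set (measurableTypeR R), measurable A -> P (Y @^-1` A) = P (Z @^-1` A).

Lemma ge0_expectation_same_law (Y Z : Omega -> R) (g : R -> R) :
  measurable_fun setT Y -> measurable_fun setT Z -> same_law Y Z ->
  measurable_fun setT g -> (forall x, 0 <= g x) ->
  (\int[P]_w (g (Y w))%:E = \int[P]_w (g (Z w))%:E)%E.
Proof.
move=> mY mZ YZ mg g0.
have E (X : Omega -> R) (mX : measurable_fun setT X) :
    (\int[P]_w (g (X w))%:E =
     \int[pushforward P (X : Omega -> measurableTypeR R)]_x (g x)%:E)%E.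
  rewrite (@ge0_integral_pushforward _ _ Omega (measurableTypeR R) R X mX P setT
    (fun x => (g x)%:E))//=; first exact/measurable_EFinP.
  by move=> x _; rewrite lee_fin.
rewrite (E Y mY) (E Z mZ); apply: eq_measure_integral => A mA _; exact: YZ.
Qed.

(** Adding the constant 1 makes the integrand nonnegative. *)
Lemma wave_same_law (Y Z : Omega -> R) c :
  measurable_fun setT Y -> measurable_fun setT Z -> same_law Y Z ->
  \int[P]_w cos (Y w + c) = \int[P]_w cos (Z w + c).
Proof.
move=> mY mZ YZ.
have mcos (X : Omega -> R) : measurable_fun setT X ->
    measurable_fun setT (fun w => cos (X w + c)).
  by move=> mX; apply: measurable_cos_comp; exact: measurable_funD.
have icos (X : Omega -> R) : measurable_fun setT X ->
    P.-integrable setT (EFin \o (fun w => cos (X w + c))).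
  move=> mX; apply: (@bounded_integrable _ _ _ _ _ 1); first exact: mcos.
  by move=> w; rewrite ler_norml cos_geN1 cos_le1.
have i1 : P.-integrable setT (EFin \o cst (1 : R)).
  exact: (@bounded_integrable _ _ _ _ _ `|1|).
have E (X : Omega -> R) : measurable_fun setT X ->
    \int[P]_w (1 + cos (X w + c)) = \int[P]_w (1:R) + \int[P]_w cos (X w + c).
  by move=> mX; rewrite RintegralD//; exact: icos.
apply: (addrI (\int[P]_w (1:R))); rewrite -!E//; congr fine.
apply: (ge0_expectation_same_law (g := fun y => 1 + cos (y + c))) => //.
  apply: measurable_funD => //; apply: measurable_cos_comp.
  exact: measurable_funD.
Qed.

End equal_laws.

(** * Linear span of a fractional Brownian motion *)
Section fbm_span.
Context d (Omega : measurableType d) (R : realType) (P : probability Omega R).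
Variables (H : R) (W : R -> {RV P >-> R}).
Hypothesis H_range : 2^-1 <= H < 1.
Hypothesis W_fbm : fractional_brownian_motion H W.

(** These are the variables on which the Gaussian hypothesis bears; as they are
    stable under linear combinations, it applies to increments and to linear
    combinations of increments. *)
Definition span (Y : Omega -> R) := exists n (t a : 'I_n -> R),
  (forall i, 0 <= t i) /\ Y = fun w => \sum_(i < n) a i * W (t i) w.

Lemma span_W t : 0 <= t -> span (W t).
Proof.
move=> t0; exists 1, (fun=> t), (fun=> 1); split => //.
by apply/funext => w; rewrite big_ord1 mul1r.
Qed.

Lemma spanZ k Y : span Y -> span (fun w => k * Y w).
Proof.
move=> [n [t [a [t0 ->]]]]; exists n, t, (fun i => k * a i); split => //.
by apply/funext => w; rewrite mulr_sumr; apply: eq_bigr => i _; rewrite mulrA.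
Qed.

Lemma spanD Y Z : span Y -> span Z -> span (fun w => Y w + Z w).
Proof.
move=> [n [t [a [t0 ->]]]] [m [r [b [r0 ->]]]].
exists (n + m)%N, (fun i => match fintype.split i with inl j => t j | inr j => r j end),
  (fun i => match fintype.split i with inl j => a j | inr j => b j end); split.
  by move=> i; case: (fintype.split i).
apply/funext => w; rewrite big_split_ord/=; congr (_ + _).
  apply: eq_bigr => i _; case: splitP => j /= ij; last by have := ltn_ord i; rewrite ij -ltn_subRL subnn.
  by have -> : i = j by exact: val_inj.
apply: eq_bigr => i _; case: splitP => j /= ij; first by have := ltn_ord j; rewrite -ij -ltn_subRL subnn.
by have -> : i = j by apply: val_inj; apply: (@addnI n).
Qed.

Lemma spanB Y Z : span Y -> span Z -> span (fun w => Y w - Z w).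
Proof.
move=> sY /(spanZ (-1)) sZ; have := spanD sY sZ.
by under eq_fun do rewrite mulN1r.
Qed.

Lemma span_sum n (a : 'I_n -> R) (X : 'I_n -> Omega -> R) :
  (forall i, span (X i)) -> span (fun w => \sum_i a i * X i w).
Proof.
move=> sX; elim: (index_enum _) => [|i s IH].
  exists 0, (fun=> 0), (fun=> 0); split => //.
  by apply/funext => w; rewrite big_nil big_ord0.
by under eq_fun do rewrite big_cons; apply: spanD => //; exact: spanZ.
Qed.

Lemma span_gaussian Y : span Y -> exists m s : R, 0 <= s /\
  forall A : set (measurableTypeR R), measurable A ->
    pushforward P Y A = gaussian_law m s A.
Proof. by move=> [n [t [a [t0 ->]]]]; exact: (fbm_gaussian W_fbm). Qed.

Lemma W_square_integrable t : 0 <= t -> square_integrable P (W t).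
Proof.
move=> t0; have mW : measurable_fun setT (W t) by exact: measurable_funPT.
split => //; have [m [s [s0 law]]] := span_gaussian (span_W t0).
have EW := fbm_mean W_fbm t0.
have := centered_gaussian_moment mW s0 law EW 1.
rewrite muln1 => m2; apply/integrableP; split.
  by apply/measurable_EFinP; exact: measurable_funX.
under eq_integral do rewrite gee0_abs ?lee_fin ?sqr_ge0//.
by rewrite m2 ltry.
Qed.

Lemma span_square_integrable Y : span Y -> square_integrable P Y.
Proof.
move=> [n [t [a [t0 ->]]]]; apply: square_integrable_sum => i.
exact: W_square_integrable.
Qed.

Lemma span_measurable Y : span Y -> measurable_fun setT Y.
Proof. by move/span_square_integrable => []. Qed.

Lemma W_mean t : 0 <= t -> \int[P]_w W t w = 0.
Proof. by move=> t0; have := fbm_mean W_fbm t0; rewrite unlock /Rintegral => ->. Qed.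

Lemma span_mean Y : span Y -> ('E_P[Y] = 0)%E.
Proof.
move=> sY; have iY := square_integrable_integrable (span_square_integrable sY).
suff Y0 : \int[P]_w Y w = 0.
  by rewrite unlock -[LHS]fineK ?integrable_fin_num// -[fine _]/(\int[P]_w Y w) Y0.
have [n [t [a [t0 ->]]]] := sY.
have := @inner_suml _ _ _ P n a (fun i => W (t i) : Omega -> R) (cst 1)
  (fun i => W_square_integrable (t0 i)) (square_integrable_cst _ _).
rewrite /inner; under eq_Rintegral do rewrite mulr1.
move=> ->; rewrite big1// => i _.
by under eq_Rintegral do rewrite mulr1; rewrite W_mean// mulr0.
Qed.

(** The [2N]-th moment of a centred Gaussian variable of variance 1. *)
Definition gaussian_moment N : R := std_moment R N / std_moment R 1 ^+ N.

Lemma gaussian_moment_ge0 N : 0 <= gaussian_moment N.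
Proof. by rewrite divr_ge0 ?exprn_ge0 ?std_moment_ge0. Qed.

Lemma span_moment Y N : span Y ->
  (\int[P]_w (Y w ^+ (2 * N))%:E = (inner P Y Y ^+ N * gaussian_moment N)%:E)%E.
Proof.
move=> sY; have mY := span_measurable sY.
have [m [s [s0 law]]] := span_gaussian sY.
have EY := span_mean sY.
have := centered_gaussian_moment mY s0 law EY.
move=> mom; rewrite mom; congr EFin.
have -> : inner P Y Y = s ^+ 2 * std_moment R 1.
  by have := mom 1%N; rewrite muln1 /inner /Rintegral => E1; rewrite [X in fine X]E1.
rewrite /gaussian_moment exprMn -exprM -mulrA; congr (_ * _).
by rewrite mulrCA divff ?mulr1// expf_neq0// gt_eqF// std_moment1_gt0.
Qed.

Lemma span_same_law Y Z : span Y -> span Z -> inner P Y Y = inner P Z Z ->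
  same_law P Y Z.
Proof.
move=> sY sZ YZ.
have [m [s [s0 law]]] := span_gaussian sY.
have [m' [s' [s0' law']]] := span_gaussian sZ.
have mE := centered_gaussian_mean (span_measurable sY) s0 law (span_mean sY).
have mE' := centered_gaussian_mean (span_measurable sZ) s0' law' (span_mean sZ).
have V := centered_gaussian_moment (span_measurable sY) s0 law (span_mean sY) 1.
have V' := centered_gaussian_moment (span_measurable sZ) s0' law' (span_mean sZ) 1.
have ss : s = s'.
  apply/eqP; rewrite -(@eqrXn2 _ 2)//; apply/eqP.
  apply: (mulIf (negbT (gt_eqF (std_moment1_gt0 R)))).
  move: V V' YZ; rewrite !muln1 /inner /Rintegral => V V'.
  by rewrite [X in fine X = _]V [X in _ = fine X]V'.
move=> A mA; apply: (etrans (law A mA)); apply: etrans (esym (law' A mA)).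
by rewrite mE mE' ss.
Qed.

(** Linear combinations of the [X k] and of the [Y k] with equal coefficients
    have equal variances, hence equal laws, and the orthant theorem applies to
    finitely many of them.  Continuity from above gives all [k]. *)
Lemma gaussian_orthants (X Y : nat -> Omega -> R) (b : nat -> R) :
  (forall k, span (X k)) -> (forall k, span (Y k)) ->
  (forall i j, inner P (X i) (X j) = inner P (Y i) (Y j)) ->
  P [set w | forall k, X k w <= b k] = P [set w | forall k, Y k w <= b k].
Proof.
move=> sX sY XY.
have fin n : P [set w | forall i : 'I_n, X i w <= b i] =
             P [set w | forall i : 'I_n, Y i w <= b i].
  apply: (@orthant_prob _ _ _ P n (fun i => X i) (fun i => Y i)).
  - by move=> i; exact: span_measurable.
  - by move=> i; exact: span_measurable.
  - move=> a c; apply: wave_same_law.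
    + by apply: span_measurable; exact: span_sum.
    + by apply: span_measurable; exact: span_sum.
    + apply: span_same_law; [exact: span_sum..|].
      rewrite !inner_sum_sum; try by move=> i; exact: span_square_integrable.
      by do 2!apply: eq_bigr => ? _; rewrite XY.
have lim (Z : nat -> Omega -> R) : (forall k, span (Z k)) ->
    P [set w | forall i : 'I_n, Z i w <= b i] @[n --> \oo] -->
    P [set w | forall k, Z k w <= b k].
  move=> sZ.
  have mS n : measurable [set w | forall i : 'I_n, Z i w <= b i].
    by apply: (measurable_orthant (Z := fun i => Z i)) => i; exact: span_measurable.
  have -> : [set w | forall k, Z k w <= b k] =
      \bigcap_n [set w | forall i : 'I_n, Z i w <= b i].
    apply/seteqP; split => w /= Zw; first by move=> n _ i; exact: Zw.
    by move=> k; exact: (Zw k.+1 I (Ordinal (ltnSn k))).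
  apply: nonincreasing_cvg_mu => //.
  - by rewrite -ge0_fin_numE// fin_num_measure.
  - exact: bigcap_measurable.
  - move=> n m nm; apply/subsetPset => w /= Zw i.
    exact: (Zw (widen_ord nm i)).
have limX := lim X sX; rewrite (funext fin) in limX.
exact: cvg_unique limX (lim Y sY).
Qed.

Lemma inner_W s t : 0 <= s -> 0 <= t -> inner P (W s) (W t) =
  2^-1 * (t `^ (2 * H) + s `^ (2 * H) - `|t - s| `^ (2 * H)).
Proof.
move=> s0 t0; have := fbm_cov W_fbm s0 t0.
rewrite unlock (fbm_mean W_fbm s0) (fbm_mean W_fbm t0)/= unlock => cov.
rewrite /inner /Rintegral; apply: (congr1 fine (y := (_)%:E)).
by rewrite -cov; apply: eq_integral => w _; rewrite !fctE /= !subr0.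
Qed.

Lemma powH0 : (0 : R) `^ (2 * H) = 0.
Proof. by have /andP[h1 h2] := H_range; rewrite powR0// gt_eqF//; lra. Qed.

Lemma inner_increment s t : 0 <= s -> 0 <= t ->
  inner P (fun w => W t w - W s w) (fun w => W t w - W s w) =
  `|t - s| `^ (2 * H).
Proof.
move=> s0 t0; have sW := W_square_integrable s0; have tW := W_square_integrable t0.
have stW : square_integrable P (fun w => W t w - W s w).
  by apply: span_square_integrable; apply: spanB; exact: span_W.
rewrite innerBl// !innerBr// !inner_W// !subrr !normr0 powH0 (distrC s t); lra.
Qed.

(** The process of increments run backwards from [t] has the covariance of the
    process itself. *)
Lemma inner_reversed t r q : 0 <= r <= t -> 0 <= q <= t ->
  inner P (fun w => W t w - W (t - r) w) (fun w => W t w - W (t - q) w) =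
  inner P (W r) (W q).
Proof.
move=> /andP[r0 rt] /andP[q0 qt].
have t0 : 0 <= t by lra.
have tr0 : 0 <= t - r by lra.
have tq0 : 0 <= t - q by lra.
have sW u : 0 <= u -> square_integrable P (W u) by exact: W_square_integrable.
have sW2 : square_integrable P (fun w => W t w - W (t - q) w).
  by apply: span_square_integrable; apply: spanB; exact: span_W.
rewrite innerBl ?innerBr ?inner_W//; try exact: sW.
have -> : t - (t - r) = r by ring.
have -> : t - q - t = - q by ring.
have -> : t - q - (t - r) = r - q by ring.
rewrite subrr normr0 powH0 normrN (ger0_norm q0) (ger0_norm r0) (distrC q r); lra.
Qed.

(** Self-similarity: time and space are rescaled together. *)
Lemma inner_scaled (c a r q : R) : 0 < a -> c ^+ 2 * a `^ (2 * H) = 1 ->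
  0 <= r -> 0 <= q ->
  inner P (fun w => c * W (a * r) w) (fun w => c * W (a * q) w) =
  inner P (W r) (W q).
Proof.
move=> a0 ca r0 q0.
have ar0 : 0 <= a * r by rewrite mulr_ge0// ltW.
have aq0 : 0 <= a * q by rewrite mulr_ge0// ltW.
have sW u : 0 <= u -> square_integrable P (W u) by exact: W_square_integrable.
rewrite innerZl; try by [exact: sW|apply: square_integrableZ; exact: sW].
rewrite innerC innerZl; try exact: sW.
rewrite !inner_W// -mulrBr normrM (gtr0_norm a0) (distrC r q).
rewrite !powRM ?normr_ge0 ?(ltW a0)//.
transitivity (c ^+ 2 * a `^ (2 * H) *
  (2^-1 * (q `^ (2 * H) + r `^ (2 * H) - `|q - r| `^ (2 * H)))); first by ring.
by rewrite ca mul1r.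
Qed.

End fbm_span.

(** * Bounds on series *)
Section series_bounds.
Variable R : realType.

Lemma nneseries_ge_term (u : nat -> \bar R) j : (forall i, 0 <= u i)%E ->
  (u j <= \sum_(i <oo) u i)%E.
Proof.
move=> u0; apply: le_trans (nneseries_lim_ge j.+1 (fun i _ _ => u0 i)).
by rewrite big_nat_recr//= leeDr// sume_ge0.
Qed.

Lemma nneseries_le_bound (u : nat -> R) (M : R) : (forall i, 0 <= u i) ->
  (forall n, \sum_(0 <= i < n) u i <= M) -> (\sum_(i <oo) (u i)%:E <= M%:E)%E.
Proof.
move=> u0 uM; apply: lime_le.
  by apply: is_cvg_nneseries => i _ _; rewrite lee_fin.
by near=> n; rewrite sumEFin lee_fin.
Unshelve. all: by end_near. Qed.

Lemma geometric_partial_sum_le (r : R) n : 0 <= r < 1 ->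
  \sum_(0 <= i < n) r ^+ i <= (1 - r)^-1.
Proof.
move=> /andP[r0 r1]; have r1' : 0 < 1 - r by rewrite subr_gt0.
suff -> : \sum_(0 <= i < n) r ^+ i = (1 - r ^+ n) / (1 - r).
  by rewrite ler_piMl ?invr_ge0 ?(ltW r1')// gerBl exprn_ge0.
elim: n => [|n IH]; first by rewrite big_nil expr0 subrr mul0r.
rewrite big_nat_recr//= IH exprS; field; exact: lt0r_neq0.
Qed.

Lemma inv_sqr_partial_sum_le n : \sum_(0 <= i < n) (i.+1%:R ^+ 2)^-1 <= 2 :> R.
Proof.
suff H m : \sum_(0 <= i < m.+1) (i.+1%:R ^+ 2)^-1 <= 2 - (m.+1%:R)^-1 :> R.
  case: n => [|n]; first by rewrite big_nil.
  by rewrite (le_trans (H n))// gerBl invr_ge0.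
elim: m => [|m IH].
  by rewrite big_nat1 expr1n invr1; lra.
rewrite big_nat_recr//=; apply: (le_trans (lerD IH (lexx _))).
rewrite -addrA lerD2l -lerBrDl opprK addrC.
have m1 : (0 : R) < m.+1%:R by rewrite ltr0n.
have -> : (m.+1%:R)^-1 - (m.+2%:R)^-1 = (m.+1%:R * m.+2%:R)^-1 :> R.
  by rewrite -[m.+2%:R]natr1; field; rewrite ?gt_eqF ?natr1 ?ltr0n.
rewrite lef_pV2 ?posrE ?mulr_gt0 ?exprn_gt0 ?ltr0n//.
by rewrite expr2 ler_wpM2r// ler_nat.
Qed.

End series_bounds.

(** * Dyadic chaining *)
Section chaining.
Variable R : realType.
Variable f : R -> R.
Hypothesis cf : continuous f.

(** At level [n + 1], an even [k] is a point of level [n] and an odd [k] is one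
    increment away from such a point.  So the bound is [e] times the sum of the
    [(3/4)^i] for [i <= n], in closed form. *)
Lemma dyadic_chain (j e : R) : 0 <= e ->
  (forall n k, (k < 2 ^ n)%N ->
     `|f (j + k.+1%:R / 2 ^+ n) - f (j + k%:R / 2 ^+ n)| <= e * (3 / 4) ^+ n) ->
  forall n k, (k <= 2 ^ n)%N ->
    `|f (j + k%:R / 2 ^+ n) - f j| <= 4 * e * (1 - (3 / 4) ^+ n.+1).
Proof.
move=> e0 incr; elim => [|n IH] k kn.
  rewrite expr0 divr1 expr1; case: k kn => [|[|//]] _.
    by rewrite addr0 subrr normr0; lra.
  by have := incr 0 0%N isT; rewrite !expr0 !divr1 addr0 mulr1; lra.
have half : (k./2 <= 2 ^ n)%N by rewrite leq_half_double (leq_trans kn)// expnS mul2n.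
have pow : (2 : R) ^+ n.+1 = 2 * 2 ^+ n by rewrite exprS.
have e2n : (2 : R) ^+ n != 0 by rewrite expf_neq0.
have evenE m : (m.*2)%:R / 2 ^+ n.+1 = m%:R / 2 ^+ n :> R.
  by rewrite pow -mul2n natrM -mulf_div divff// mul1r.
have bn : 0 <= e * (3 / 4) ^+ n.+1 by rewrite mulr_ge0// exprn_ge0//; lra.
rewrite -(odd_double_half k) in kn *.
have := IH _ half; rewrite [(3/4) ^+ n.+2]exprS.
case: (odd k) kn => kn; last by rewrite add0n evenE; move: bn; lra.
have km : (k./2.*2 < 2 ^ n.+1)%N by [].
have := incr n.+1 _ km; rewrite add1n -evenE.
set A := f _; set B := f _; move=> h1 h2.
have := ler_normD (A - B) (B - f j).
rewrite addrA subrK; move: bn h1 h2; lra.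
Qed.

(** Dyadic points are dense in the block and [f] is continuous. *)
Lemma block_oscillation (j e : R) : 0 <= e ->
  (forall n k, (k < 2 ^ n)%N ->
     `|f (j + k.+1%:R / 2 ^+ n) - f (j + k%:R / 2 ^+ n)| <= e * (3 / 4) ^+ n) ->
  forall t, j <= t <= j + 1 -> `|f t - f j| <= 4 * e.
Proof.
move=> e0 incr t /andP[jt tj].
pose k n := Num.truncn ((t - j) * 2 ^+ n).
have p2 n : (0 : R) < 2 ^+ n by rewrite exprn_gt0.
have knge n : 0 <= (t - j) * 2 ^+ n by rewrite mulr_ge0 ?subr_ge0// ltW.
have kle n : (k n)%:R / 2 ^+ n <= t - j.
  by rewrite ler_pdivrMr//; have /andP[] := truncn_itv (knge n).
have kgt n : t - j - (2 ^+ n)^-1 <= (k n)%:R / 2 ^+ n.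
  rewrite ler_pdivlMr// mulrBl mulVf ?gt_eqF// lerBlDr natr1 ltW//.
  by have /andP[] := truncn_itv (knge n).
have kn n : (k n <= 2 ^ n)%N.
  rewrite -(ler_nat R) natrX -[leRHS]mul1r -ler_pdivrMr//.
  by rewrite (le_trans (kle n))//; lra.
have ktj : j + (k n)%:R / 2 ^+ n @[n --> \oo] --> t.
  apply: (squeeze_cvgr (f := fun n => t - (2^-1) ^+ n) (h := cst t)).
  - near=> n; rewrite exprVn /=; have := kle n; have := kgt n.
    by move=> ? ?; apply/andP; split; lra.
  - rewrite -[X in _ --> X]subr0; apply: cvgB; first exact: cvg_cst.
    by apply: cvg_expr; rewrite ger0_norm//; lra.
  - exact: cvg_cst.
have fk : `|f (j + (k n)%:R / 2 ^+ n) - f j| @[n --> \oo] --> `|f t - f j|.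
  apply: cvg_norm; apply: cvgB; last exact: cvg_cst.
  by apply: continuous_cvg; [exact: cf|exact: ktj].
apply: (cvgr_to_le fk); near=> n.
apply: le_trans (dyadic_chain e0 incr (kn n)) _.
by rewrite ler_piMr ?mulr_ge0// gerBl exprn_ge0//; lra.
Unshelve. all: by end_near. Qed.

(** On [[j, j + 1]] the right-hand side [y + v j] is split in two halves: one
    for [f j], one for the oscillation.  The latter is [4 e] by the previous
    lemma, which is why the increments carry the factor [8 = 2 * 4]. *)
Lemma linear_bound (v y : R) : 0 <= v -> 0 <= y ->
  (forall j : nat, 2 * `|f j%:R| <= y + v * j%:R) ->
  (forall (j n k : nat), (k < 2 ^ n)%N ->
     8 * (4 / 3) ^+ n *
       `|f (j%:R + k.+1%:R / 2 ^+ n) - f (j%:R + k%:R / 2 ^+ n)|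
     <= y + v * j%:R) ->
  forall t, 0 <= t -> f t - v * t <= y.
Proof.
move=> v0 y0 hj hincr t t0.
pose j := Num.truncn t; have /andP[jt tj] := truncn_itv t0.
pose e := (y + v * j%:R) / 8.
have e0 : 0 <= e by rewrite divr_ge0// addr_ge0// mulr_ge0.
have osc : `|f t - f j%:R| <= 4 * e.
  apply: block_oscillation => //; last by rewrite jt/= natr1 ltW.
  move=> n k kn; have := hincr j n k kn.
  have p : 0 < (4 / 3 : R) ^+ n by rewrite exprn_gt0//; lra.
  have -> : (3 / 4 : R) ^+ n = ((4 / 3) ^+ n)^-1 by rewrite -exprVn invf_div.
  rewrite ler_pdivlMr// /e; lra.
have := hj j; have := ler_norm (f t - f j%:R); have := ler_norm (f j%:R).
have : v * j%:R <= v * t by rewrite ler_wpM2l.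
rewrite /e in osc; lra.
Qed.

End chaining.

(** * Moments of the all-time maximum *)
(** Paths are continuous on [[0, +oo[] only; clamping the time gives functions
    continuous on the whole line. *)
Lemma continuous_max0 (R : realType) (f : R -> R) :
  {within `[0, +oo[, continuous f} -> continuous (fun t : R => f (Num.max 0 t)).
Proof.
move=> cf x.
have m0 (y : R) : `[0, +oo[%classic (Num.max 0 y).
  by rewrite /= in_itv/= andbT le_max lexx.
move=> U /= Uf; have := (subspace_continuousP _ _).1 cf _ (m0 x) U Uf.
rewrite /within/= => nbU.
have cm : continuous (fun y : R => Num.max 0 y).
  move=> y; apply: (continuous_max (f := cst 0 : R -> R^o) (g := idfun)).
    exact: cvg_cst.
  exact: cvg_id.
by apply: (@filterS _ (nbhs x) _ _ _ _ (cm x _ nbU)) => y /= /(_ (m0 y)).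
Qed.

Section supremum_moment.
Context d (Omega : measurableType d) (R : realType) (P : probability Omega R).
Variables (H : R) (W : R -> {RV P >-> R}).
Hypothesis H_range : 2^-1 <= H < 1.
Hypothesis W_fbm : fractional_brownian_motion H W.
Variables (v : R) (q N : nat).
Hypothesis v0 : 0 < v.
Hypothesis N6 : (6 <= N)%N.
Hypothesis qN : (q <= 2 * N)%N.
Hypothesis qNH : q%:R + 2 <= (2 * N)%:R * (1 - H).

Let c : R := Num.min 1 v.
Let c0 : 0 < c. Proof. by rewrite lt_min ltr01 v0. Qed.

(** The weight turns the bound [S <= y ^ q] on the sum [S] of the weighted terms
    into [x ^ (2N) <= (c (j + 1)) ^ (2N - q) y ^ q <= (y + v j) ^ (2N)] for every
    quantity [x] of block [j]; the choice [c = min 1 v] makes the last step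
    valid as soon as [y >= 1]. *)
Definition block_weight (j : nat) : R := ((c * j.+1%:R) ^+ (2 * N - q))^-1.

(** This power and the next one are those of the quantities that [linear_bound]
    asks to be at most [y + v j]. *)
Definition block_start j w : R := (2 * W j%:R w) ^+ (2 * N).

Definition block_incr j n k w : R :=
  (8 * (4 / 3) ^+ n *
    (W (j%:R + k.+1%:R / 2 ^+ n) w - W (j%:R + k%:R / 2 ^+ n) w)) ^+ (2 * N).

(** Sums of [2N]-th powers stand for the maxima over [n] and [k]: they bound them
    and their expectations are explicit. *)
Definition chaining_block j w : \bar R :=
  ((block_start j w)%:E +
   \sum_(n <oo) (\sum_(k < 2 ^ n) block_incr j n k w)%:E)%E.

Definition chaining_series w : \bar R :=
  (\sum_(j <oo) ((block_weight j)%:E * chaining_block j w))%E.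

Let even_ge0 (x : R) M : 0 <= x ^+ (2 * M).
Proof. by rewrite exprM exprn_ge0// sqr_ge0. Qed.

Let weight_gt0 j : 0 < block_weight j.
Proof. by rewrite invr_gt0 exprn_gt0// mulr_gt0. Qed.

Let incrs_ge0 j w n : (0 <= (\sum_(k < 2 ^ n) block_incr j n k w)%:E)%E.
Proof. by rewrite lee_fin sumr_ge0// => k _; exact: even_ge0. Qed.

Let block_ge0 j w : (0 <= chaining_block j w)%E.
Proof.
rewrite adde_ge0 ?lee_fin ?even_ge0//.
by apply: nneseries_ge0 => n _ _; exact: incrs_ge0.
Qed.

Lemma chaining_series_ge0 w : (0 <= chaining_series w)%E.
Proof.
apply: nneseries_ge0 => j _ _; rewrite mule_ge0// lee_fin ltW//.
Qed.

(** Every term of the series is at most [y ^ q], so every quantity of block [j]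
    is at most [y + v j], and [linear_bound] applies. *)
Lemma chaining_series_bound w y : 1 <= y -> (chaining_series w <= (y ^+ q)%:E)%E ->
  forall t, 0 <= t -> W t w - v * t <= y.
Proof.
move=> y1 Sy t t0.
have y0 : 0 <= y by lra.
have posmax s : 0 <= s -> Num.max 0 s = s by move=> ?; apply/max_idPr.
have cyv j : 0 <= c * j.+1%:R <= y + v * j%:R.
  rewrite mulr_ge0 ?(ltW c0)//= -natr1 mulrDr mulr1 addrC lerD//.
    by rewrite ge_min y1.
  by rewrite ler_wpM2r// ge_min lexx orbT.
have key j x : ((block_weight j)%:E * (x ^+ (2 * N))%:E <= (y ^+ q)%:E)%E ->
    `|x| <= y + v * j%:R.
  rewrite -EFinM lee_fin /block_weight mulrC.
  rewrite ler_pdivrMr ?exprn_gt0 ?mulr_gt0// => xy.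
  have yv0 : 0 <= y + v * j%:R by rewrite addr_ge0// mulr_ge0// ltW.
  have N0 : (0 < 2 * N)%N by rewrite muln_gt0 (leq_trans _ N6).
  rewrite -(ler_pXn2r N0) ?nnegrE//.
  have -> : `|x| ^+ (2 * N) = x ^+ (2 * N).
    by rewrite !exprM real_normK// num_real.
  apply: le_trans xy _; have /andP[h1 h2] := cyv j.
  rewrite -[in leRHS](subnKC qN) exprD ler_pM ?exprn_ge0//.
    by apply: lerXn2r; rewrite ?nnegrE// lerDl mulr_ge0// ltW.
  by apply: lerXn2r; rewrite ?nnegrE.
have le_y j : ((block_weight j)%:E * chaining_block j w <= (y ^+ q)%:E)%E.
  apply: le_trans Sy; apply: nneseries_ge_term (fun j => (block_weight j)%:E * chaining_block j w)%E _ _ => i.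
  by rewrite mule_ge0// lee_fin ltW.
suff : W (Num.max 0 t) w - v * t <= y by rewrite posmax.
apply: (@linear_bound _ (fun s => W (Num.max 0 s) w)) => //.
- apply: (continuous_max0 (f := W^~ w)); exact: fbm_continuous W_fbm w.
- exact: ltW.
- move=> j; rewrite posmax//.
  have := key j (2 * W j%:R w); rewrite normrM ger0_norm//; apply.
  apply: le_trans (le_y j); apply: lee_wpmul2l; first by rewrite lee_fin ltW.
  rewrite /chaining_block leeDl//.
  by apply: nneseries_ge0 => n _ _; exact: incrs_ge0.
- move=> j n k kn; rewrite !posmax; last 2 first.
  + by rewrite addr_ge0// divr_ge0// exprn_ge0.
  + by rewrite addr_ge0// divr_ge0// exprn_ge0.
  have := key j (8 * (4 / 3) ^+ n *
    (W (j%:R + k.+1%:R / 2 ^+ n) w - W (j%:R + k%:R / 2 ^+ n) w)).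
  rewrite normrM (@ger0_norm _ (8 * _)); last by rewrite mulr_ge0// exprn_ge0//; lra.
  apply; apply: le_trans (le_y j); apply: lee_wpmul2l; first by rewrite lee_fin ltW.
  rewrite /chaining_block; apply: (@le_trans _ _ (\sum_(n <oo) (\sum_(k < 2 ^ n) block_incr j n k w)%:E)%E); last first.
    by rewrite leeDr// lee_fin; exact: even_ge0.
  apply: le_trans (nneseries_ge_term n (incrs_ge0 j w)).
  rewrite lee_fin (bigD1 (Ordinal kn))//= -/(block_incr j n k w) lerDl.
  by apply: sumr_ge0 => i _; exact: even_ge0.
Qed.

Let mW t : measurable_fun setT (W t).
Proof. exact: measurable_funPT. Qed.

Let m_incr j n k : measurable_fun setT (block_incr j n k).
Proof.
by apply: measurable_funX; apply: measurable_funM => //; exact: measurable_funB.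
Qed.

Let m_start j : measurable_fun setT (block_start j).
Proof. by apply: measurable_funX; exact: measurable_funM. Qed.

Let m_incrs j n : measurable_fun setT (fun w => (\sum_(k < 2 ^ n) block_incr j n k w)%:E).
Proof. by apply/measurable_EFinP; apply: measurable_sum => k; exact: m_incr. Qed.

Let m_block j : measurable_fun setT (chaining_block j).
Proof.
apply: emeasurable_funD; first exact/measurable_EFinP.
by apply: ge0_emeasurable_sum => [n w _ _|n _]; [exact: incrs_ge0|exact: m_incrs].
Qed.

Lemma measurable_chaining_series : measurable_fun setT chaining_series.
Proof.
apply: ge0_emeasurable_sum => [j w _ _|j _].
  by rewrite mule_ge0// lee_fin ltW.
exact: measurable_funeM.
Qed.

Let CN := gaussian_moment R N.

Lemma expectation_block_start j :
  (\int[P]_w (block_start j w)%:E <=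
   (4 ^+ N * CN * (j.+1%:R `^ (2 * H)) ^+ N)%:E)%E.
Proof.
have s : span W (fun w => 2 * W j%:R w) by apply: spanZ; exact: span_W.
rewrite (span_moment W_fbm N s) lee_fin mulrAC ler_wpM2r ?gaussian_moment_ge0//.
rewrite -exprMn lerXn2r ?nnegrE ?mulr_ge0 ?powR_ge0//.
  by apply: Rintegral_ge0 => w _; rewrite -expr2 sqr_ge0.
have sW := W_square_integrable W_fbm (ler0n R j).
rewrite innerZl//; last exact: square_integrableZ.
rewrite innerC innerZl// (inner_W W_fbm)// subrr normr0 (powH0 H_range) mulrA.
rewrite -natrM ler_wpM2l// subr0.
have : j%:R `^ (2 * H) <= j.+1%:R `^ (2 * H) :> R.
  by apply: ge0_ler_powR; rewrite ?nnegrE// ?ler_nat//; have /andP[? ?] := H_range; lra.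
lra.
Qed.

(** The variance of the rescaled increment is [64 (16/9)^n (2^-n)^(2H)], at most [64 (8/9)^n]. *)
Lemma expectation_block_incr j n k :
  (\int[P]_w (block_incr j n k w)%:E <= (64 ^+ N * CN * ((8 / 9) ^+ N) ^+ n)%:E)%E.
Proof.
have p2 : (0 : R) < 2 ^+ n by rewrite exprn_gt0.
have p1 (m : nat) : 0 <= j%:R + m%:R / 2 ^+ n :> R by rewrite addr_ge0// divr_ge0// ltW.
have sI : span W (fun w => W (j%:R + k.+1%:R / 2 ^+ n) w - W (j%:R + k%:R / 2 ^+ n) w).
  by apply: spanB; exact: span_W.
have qI := span_square_integrable W_fbm sI.
rewrite (span_moment W_fbm N (spanZ _ sI)) lee_fin mulrAC.
rewrite ler_wpM2r ?gaussian_moment_ge0//.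
rewrite -exprM mulnC exprM -exprMn lerXn2r ?nnegrE.
- by [].
- by apply: Rintegral_ge0 => w _; rewrite -expr2 sqr_ge0.
- by rewrite mulr_ge0// exprn_ge0//; lra.
rewrite innerZl//; last exact: square_integrableZ.
rewrite innerC innerZl// (inner_increment H_range W_fbm)//.
have -> : j%:R + k.+1%:R / 2 ^+ n - (j%:R + k%:R / 2 ^+ n) = (2 ^+ n)^-1 :> R.
  by rewrite -natr1; field; rewrite gt_eqF.
rewrite gtr0_norm ?invr_gt0// mulrA.
have -> : 8 * (4 / 3) ^+ n * (8 * (4 / 3) ^+ n) = 64 * (16 / 9) ^+ n :> R.
  by rewrite mulrACA -exprMn; congr (_ * _ ^+ _); field.
rewrite -mulrA ler_wpM2l//.
have -> : (8 / 9 : R) ^+ n = (16 / 9) ^+ n * (2 ^+ n)^-1.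
  by rewrite -exprVn -exprMn; congr (_ ^+ _); field.
apply: ler_wpM2l; first by rewrite exprn_ge0 // divr_ge0.
(* since 2 H >= 1 and 2^-n <= 1 *)
by apply: ge1r_powR; [rewrite invr_gt0 p2/= invf_le1// exprn_ege1// ler1n|have /andP[? ?] := H_range; lra].
Qed.

(** Level [n] has [2^n] increments, each with expectation of order
    [((8/9)^N)^n]; [N = 6] is the first exponent for which their sum is
    geometric with ratio below 1. *)
Let rho : R := 2 * (8 / 9) ^+ 6.
Let rho01 : 0 <= rho < 1. Proof. by rewrite /rho; apply/andP; split; lra. Qed.

Let rho_inv0 : 0 <= (1 - rho)^-1.
Proof. by rewrite invr_ge0 subr_ge0 ltW//; case/andP: rho01. Qed.

Let block_moment : R := 4 ^+ N * CN + 64 ^+ N * CN / (1 - rho).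

Let CN0 : 0 <= CN. Proof. exact: gaussian_moment_ge0. Qed.

Lemma expectation_block_incrs j n :
  (\int[P]_w (\sum_(k < 2 ^ n) block_incr j n k w)%:E <=
   (64 ^+ N * CN * rho ^+ n)%:E)%E.
Proof.
under eq_integral do rewrite -sumEFin.
rewrite ge0_integral_sum//; last 2 first.
- by move=> k; apply/measurable_EFinP; exact: m_incr.
- by move=> k w _; rewrite lee_fin; exact: even_ge0.
apply: (@le_trans _ _ (\sum_(k < 2 ^ n) (64 ^+ N * CN * ((8 / 9) ^+ N) ^+ n)%:E)%E).
  by apply: lee_sum => k _; exact: expectation_block_incr.
rewrite sumEFin lee_fin sumr_const card_ord -[leLHS]mulr_natl natrX mulrCA.
apply: ler_wpM2l; first by rewrite mulr_ge0// exprn_ge0.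
rewrite -exprMn lerXn2r ?nnegrE ?mulr_ge0 ?exprn_ge0//; try lra.
by rewrite ler_wpM2l// ler_wiXn2l//; lra.
Qed.

Lemma expectation_chaining_block j :
  (\int[P]_w chaining_block j w <=
   (block_moment * (j.+1%:R `^ (2 * H)) ^+ N)%:E)%E.
Proof.
rewrite ge0_integralD//; last 4 first.
- by move=> w _; rewrite lee_fin; exact: even_ge0.
- exact/measurable_EFinP.
- by move=> w _; apply: nneseries_ge0 => n _ _; exact: incrs_ge0.
- by apply: ge0_emeasurable_sum => [n w _ _|n _]; [exact: incrs_ge0|exact: m_incrs].
rewrite integral_nneseries//.
have [r0 r1] := andP rho01.
have x1 : 1 <= j.+1%:R `^ (2 * H) :> R.
  rewrite -[leLHS](powRr0 j.+1%:R); apply: ler_powR; first by rewrite ler1n.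
  by have /andP[? ?] := H_range; lra.
have a0 : 0 <= 64 ^+ N * CN by rewrite mulr_ge0 ?exprn_ge0.
rewrite /block_moment mulrDl EFinD; apply: leeD; first exact: expectation_block_start.
apply: (@le_trans _ _ (\sum_(n <oo) (64 ^+ N * CN * rho ^+ n)%:E)%E).
  apply: lee_nneseries => n _; last exact: expectation_block_incrs.
  by move=> _; apply: integral_ge0 => w _; exact: incrs_ge0.
apply: (@le_trans _ _ (64 ^+ N * CN / (1 - rho))%:E); last first.
  rewrite lee_fin ler_peMr ?exprn_ege1//.
  by rewrite (mulr_ge0 a0 rho_inv0).
apply: nneseries_le_bound => n; first by rewrite (mulr_ge0 a0 (exprn_ge0 _ r0)).
rewrite -mulr_sumr; apply: (ler_wpM2l a0).
exact: geometric_partial_sum_le rho01.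
Qed.

(** The hypothesis [qNH] says that the exponent [2N - q] of the weight exceeds
    the exponent [2HN] of the moment by at least 2, so that the blocks
    have a summable series of expectations. *)
Lemma block_weight_summable j :
  block_weight j * (j.+1%:R `^ (2 * H)) ^+ N <=
  (c ^+ (2 * N - q))^-1 * (j.+1%:R ^+ 2)^-1.
Proof.
have x1 : 1 <= j.+1%:R :> R by rewrite ler1n.
have x0 : 0 < j.+1%:R :> R by rewrite ltr0n.
have /andP[h1 h2] := H_range.
have m2R : (2 : R) <= (2 * N - q)%:R.
  rewrite natrB// lerBrDr addrC (le_trans qNH)// ler_piMr//; lra.
have m2 : (2 <= 2 * N - q)%N by rewrite -(ler_nat R).
rewrite /block_weight exprMn invfM -mulrA ler_wpM2l ?invr_ge0 ?exprn_ge0 ?(ltW c0)//.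
rewrite mulrC ler_pdivrMr ?exprn_gt0// [leRHS]mulrC ler_pdivlMr ?exprn_gt0//.
rewrite -(subnK m2) exprD ler_wpM2r ?exprn_ge0 ?(ltW x0)//.
rewrite -!powR_mulrn ?powR_ge0 ?(ltW x0)// -powRrM; apply: ler_powR => //.
rewrite natrB// natrB//.
have -> : 2 * H * N%:R = (2 * N)%:R * H by rewrite natrM mulrAC.
by move: qNH; rewrite mulrBr mulr1; lra.
Qed.

Lemma chaining_series_integrable : (\int[P]_w chaining_series w < +oo)%E.
Proof.
have [r0 r1] := andP rho01.
have bm0 : 0 <= block_moment.
  have a0 : 0 <= 64 ^+ N * CN by rewrite mulr_ge0 ?exprn_ge0.
  by rewrite addr_ge0 ?(mulr_ge0 a0 rho_inv0)// mulr_ge0 ?exprn_ge0.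
have cc0 : 0 <= (c ^+ (2 * N - q))^-1 by rewrite invr_ge0 exprn_ge0// ltW.
rewrite integral_nneseries//; last 2 first.
- by move=> j; exact: measurable_funeM.
- by move=> j w _; rewrite mule_ge0// lee_fin ltW.
pose K := block_moment * (c ^+ (2 * N - q))^-1.
apply: (@le_lt_trans _ _ (\sum_(j <oo) (K * (j.+1%:R ^+ 2)^-1)%:E)%E).
  apply: lee_nneseries => [j _ _|j _].
    by apply: integral_ge0 => w _; rewrite mule_ge0// lee_fin ltW.
  rewrite ge0_integralZl//; last by rewrite lee_fin ltW.
  apply: (@le_trans _ _ ((block_weight j)%:E *
      (block_moment * (j.+1%:R `^ (2 * H)) ^+ N)%:E)%E).
    by apply: lee_wpmul2l; [rewrite lee_fin ltW|exact: expectation_chaining_block].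
  rewrite -EFinM lee_fin mulrCA /K -mulrA ler_wpM2l//.
  exact: block_weight_summable.
apply: (@le_lt_trans _ _ (K * 2)%:E); last exact: ltry.
apply: nneseries_le_bound => [j|n].
  by rewrite !mulr_ge0// invr_ge0 exprn_ge0.
by rewrite -mulr_sumr ler_wpM2l ?mulr_ge0//; exact: inv_sqr_partial_sum_le.
Qed.

End supremum_moment.

(** * Laws on the line and dense times *)
Section laws_on_the_line.
Context d (Omega : measurableType d) (R : realType) (P : probability Omega R).

Lemma measurable_fun_sublevel d' (T : measurableType d') (f : T -> R) :
  (forall y, measurable [set w | f w <= y]) -> measurable_fun setT f.
Proof.
move=> mf mD; apply: (measurability _ (RGenOInfty.measurableE R)) => //.
move=> /= _ [_ [x ->] <-]; rewrite setTI.
rewrite (_ : _ @^-1` _ = ~` [set w | f w <= x]); first exact: measurableC.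
by apply/seteqP; split => w /=; rewrite in_itv/= andbT ltNge => /negP.
Qed.

(** Open half-lines are stable under intersection and generate the Borel sets. *)
Lemma same_law_cdf (X Y : Omega -> R) :
  measurable_fun setT X -> measurable_fun setT Y ->
  (forall y, P [set w | X w <= y] = P [set w | Y w <= y]) -> same_law P X Y.
Proof.
move=> mX mY XY A mA.
have tail (Z : Omega -> R) x : measurable_fun setT Z ->
    P (Z @^-1` `]x, +oo[) = (1 - P [set w | (Z w <= x)%R])%E.
  move=> mZ; rewrite -probability_setC; last exact: measurable_sublevel.
  congr (P _); apply/seteqP; split => w /=; rewrite in_itv/= andbT ltNge.
    by move/negP.
  by move=> ?; apply/negP.
pose lawX := distribution P (mfun_Sub (mem_set mX) : {mfun Omega >-> R}).
pose lawY := distribution P (mfun_Sub (mem_set mY) : {mfun Omega >-> R}).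
suff : lawX A = lawY A by [].
apply: (@measure_unique _ R R (@RGenOInfty.G R)
  (fun n => `](- n%:R : R), +oo[%classic) _ _ _ _ lawX lawY) => //.
- exact: RGenOInfty.measurableE.
- move=> _ _ [x ->] [y ->]; exists (Num.max x y).
  by apply/seteqP; split => z /=; rewrite !in_itv/= !andbT gt_max => /andP.
- by move=> n; exists (- n%:R).
- apply/seteqP; split => // x _; exists (Num.truncn `|x|).+1 => //=.
  rewrite in_itv/= andbT ltrNl (le_lt_trans (ler_norm _))// normrN.
  by have /andP[] := truncn_itv (normr_ge0 x).
- by move=> _ [x ->]; rewrite -[LHS]/(P (X @^-1` `]x, +oo[)) -[RHS]/(P (Y @^-1` `]x, +oo[)) !tail// XY.
- move=> n; apply: le_lt_trans (ltry 1); apply: probability_le1.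
  exact: measurable_itv.
Qed.

End laws_on_the_line.

Section dense_times.
Variable R : realType.
Implicit Types g : R -> R.

Definition dense_time (k : nat) : R :=
  let: (a, b) := odflt (0, 0)%N (unpickle k) in a%:R / b.+1%:R.

Lemma dense_time_ge0 k : 0 <= dense_time k.
Proof. by rewrite /dense_time; case: (odflt _ _) => a b; rewrite divr_ge0. Qed.

Definition floor_time n (t : R) : R := (Num.truncn (t * n.+1%:R))%:R / n.+1%:R.

Lemma floor_time_cvg t : 0 <= t -> floor_time n t @[n --> \oo] --> t.
Proof.
move=> t0; have n0 n : (0 : R) < n.+1%:R by rewrite ltr0n.
apply: (squeeze_cvgr (f := fun n => t - n.+1%:R^-1) (h := cst t)).
- near=> n; have /andP[h1 h2] := @truncn_itv R (t * n.+1%:R) (mulr_ge0 t0 (ler0n _ _)).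
  rewrite /floor_time /cst ler_pdivrMr// h1 andbT ler_pdivlMr// mulrBl mulVf ?gt_eqF//.
  by rewrite lerBlDr natr1 ltW.
- rewrite -[X in _ --> X]subr0; apply: cvgB; first exact: cvg_cst.
  exact: cvg_harmonic.
- exact: cvg_cst.
Unshelve. all: by end_near. Qed.

Lemma le_dense_times g y : continuous g ->
  (forall k, g (dense_time k) <= y) -> forall t, 0 <= t -> g t <= y.
Proof.
move=> cg gy t t0.
have gt : g (floor_time n t) @[n --> \oo] --> g t.
  by apply: continuous_cvg; [exact: cg|exact: floor_time_cvg].
apply: (cvgr_to_le gt); near=> n.
by have := gy (pickle (Num.truncn (t * n.+1%:R), n)); rewrite /dense_time pickleK.
Unshelve. all: by end_near. Qed.

Lemma continuous_min_comp g t : continuous g ->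
  continuous (fun s : R => g (Num.min s t)).
Proof.
move=> cg x; apply: (continuous_comp (f := fun s : R => Num.min s t) (g := g)).
  apply: (continuous_min (f := idfun : R -> R^o) (g := cst t)); [exact: cvg_id|exact: cvg_cst].
exact: cg.
Qed.

(** Clamping the dense times at [t] keeps them dense in [[0, t]] and includes
    the end point. *)
Lemma le_dense_times_itv g y t : continuous g -> 0 <= t ->
  (forall k, g (Num.min (dense_time k) t) <= y) ->
  forall s, 0 <= s <= t -> g s <= y.
Proof.
move=> cg t0 gy s /andP[s0 st].
have := le_dense_times (continuous_min_comp (t := t) cg) gy s0.
by rewrite (min_idPl st).
Qed.

Lemma min_dense_time k t : 0 <= t -> 0 <= Num.min (dense_time k) t <= t.
Proof. by move=> t0; rewrite le_min dense_time_ge0 t0 ge_min lexx orbT. Qed.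

End dense_times.

(** * Extrema of a path and joint measurability *)
Section path_extrema.
Variables (R : realType) (g : R -> R).

Lemma le_inf_itv (t z : R) : {within `[0, t], continuous g} -> 0 <= t ->
  z <= inf [set g s | s in `[0, t]] <-> forall s, 0 <= s <= t -> z <= g s.
Proof.
move=> cg t0; have [c ct gc] := EVT_min t0 cg; split => [zi s st|zg].
  apply: le_trans zi _; apply: ge_inf; last by exists s; rewrite //= in_itv.
  by exists (g c) => _ /= [r rt <-]; exact: gc.
apply: lb_le_inf; first by exists (g 0), 0; rewrite //= in_itv/= lexx.
by move=> _ /= [r + <-]; rewrite in_itv; exact: zg.
Qed.

Lemma sup_itv_le (t z : R) : {within `[0, t], continuous g} -> 0 <= t ->
  sup [set g s | s in `[0, t]] <= z <-> forall s, 0 <= s <= t -> g s <= z.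
Proof.
move=> cg t0; have [c ct gc] := EVT_max t0 cg; split => [iz s st|zg].
  apply: le_trans iz; apply: ub_le_sup; last by exists s; rewrite //= in_itv.
  by exists (g c) => _ /= [r rt <-]; exact: gc.
apply: ge_sup; first by exists (g 0), 0; rewrite //= in_itv/= lexx.
by move=> _ /= [r + <-]; rewrite in_itv; exact: zg.
Qed.

Definition bounded_above := exists y, forall s, 0 <= s -> g s <= y.

Lemma le_sup_ray s : bounded_above -> 0 <= s -> g s <= sup [set g r | r in `[0, +oo[].
Proof.
move=> [y gy] s0; apply: ub_le_sup; last by exists s; rewrite //= in_itv/= s0.
by exists y => _ /= [r + <-]; rewrite in_itv/= andbT; exact: gy.
Qed.

Lemma sup_ray_le y : (forall s, 0 <= s -> g s <= y) ->
  sup [set g r | r in `[0, +oo[] <= y.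
Proof.
move=> gy; apply: ge_sup; first by exists (g 0), 0; rewrite //= in_itv/= lexx.
by move=> _ /= [r + <-]; rewrite in_itv/= andbT; exact: gy.
Qed.

Lemma sup_ray_ge0 : g 0 = 0 -> 0 <= sup [set g r | r in `[0, +oo[].
Proof.
move=> g0; case: (pselect bounded_above) => [bg|nbg].
  by have := le_sup_ray bg (lexx 0); rewrite g0.
rewrite sup_out// => -[_ [y gy]]; apply: nbg; exists y => s s0.
by apply: gy; exists s; rewrite //= in_itv/= s0.
Qed.

(** An unbounded set has supremum 0 by convention. *)
Lemma sup_ray_unbounded : ~ bounded_above -> sup [set g r | r in `[0, +oo[] = 0.
Proof.
move=> nbg; rewrite sup_out// => -[_ [y gy]]; apply: nbg; exists y => s s0.
by apply: gy; exists s; rewrite //= in_itv/= s0.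
Qed.

End path_extrema.

Section joint_measurability.
Context d (Omega : measurableType d) (R : realType) (W : R -> Omega -> R).
Hypothesis mW : forall t, 0 <= t -> measurable_fun setT (W t).
Hypothesis cW : forall w, continuous (fun t : R => W (Num.max 0 t) w).

(** A process with continuous paths is the limit of its values at the times
    [floor_time n], and these take countably many values. *)
Lemma measurable_joint (d' : measure_display) (T : measurableType d')
    (tau : T -> R) (om : T -> Omega) :
  measurable_fun setT tau -> measurable_fun setT om ->
  (forall z, 0 <= tau z) ->
  measurable_fun setT (fun z => W (tau z) (om z)).
Proof.
move=> mtau mom tau0.
have max0 z : Num.max 0 (tau z) = tau z by apply/max_idPr.
apply: (@measurable_realfun.measurable_fun_cvg _ _ _ _
  (fun n z => W (floor_time n (tau z)) (om z))); last first.
  move=> z _; rewrite -[in X in _ --> X](max0 z).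
  have floor0 n : Num.max 0 (floor_time n (tau z)) = floor_time n (tau z).
    by apply/max_idPr; rewrite /floor_time divr_ge0.
  have : W (Num.max 0 (floor_time n (tau z))) (om z) @[n --> \oo] -->
         W (Num.max 0 (tau z)) (om z).
    apply: (@continuous_cvg _ R R _ _ _ (fun t : R => W (Num.max 0 t) (om z))).
      exact: cW.
    exact: floor_time_cvg.
  by rewrite (funext (fun n => congr1 (W^~ (om z)) (floor0 n))).
move=> n; apply: measurable_fun_sublevel => y.
rewrite (_ : [set z | _] = \bigcup_m
   (([set z | m%:R <= tau z * n.+1%:R] `\` [set z | m.+1%:R <= tau z * n.+1%:R])
     `&` [set z | W (m%:R / n.+1%:R) (om z) <= y])); last first.
  have tn0 z : 0 <= tau z * n.+1%:R by rewrite mulr_ge0.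
  apply/seteqP; split => z /=.
    move=> Wy; exists (Num.truncn (tau z * n.+1%:R)) => //; split => //=.
    have /andP[h1 h2] := truncn_itv (tn0 z); split => //.
    by apply/negP; rewrite -ltNge.
  move=> [m _ [[/= h1 /negP h2] Wy]]; rewrite /floor_time.
  suff -> : Num.truncn (tau z * n.+1%:R) = m by [].
  by apply/eqP; rewrite truncn_eq// h1 ltNge.
have lev (a : R) : measurable [set z | a <= tau z * n.+1%:R].
  rewrite (_ : [set z | _] = [set z | - (tau z * n.+1%:R) <= - a]).
    by apply: measurable_sublevel; apply: measurableT_comp => //; exact: measurable_funM.
  by apply/seteqP; split => z /=; rewrite lerN2.
apply: bigcup_measurable => m _; apply: measurableI; first exact: measurableD.
apply: measurable_sublevel; apply: measurableT_comp => //.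
by apply: mW; rewrite divr_ge0.
Qed.

End joint_measurability.

(** * The reflected process and its dual *)
Section drifted_process.
Context d (Omega : measurableType d) (R : realType) (P : probability Omega R).
Variables (H : R) (W : R -> {RV P >-> R}).
Hypothesis H_range : 2^-1 <= H < 1.
Hypothesis W_fbm : fractional_brownian_motion H W.
Implicit Types (c u v x y t : R) (w : Omega).

Definition drifted_fbm c u t w : R := c * W t w - u * t.

Definition fbm_peak c u w : R := sup [set drifted_fbm c u s w | s in `[0, +oo[].

(** Reversal of time gives this the law of the state at [t]; unlike the state,
    it converges along each path as [t] grows. *)
Definition reflected_dual c u x t w : R :=
  Num.max (x + drifted_fbm c u t w) (sup [set drifted_fbm c u s w | s in `[0, t]]).

Lemma continuous_path w : continuous (fun t : R => W (Num.max 0 t) w).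
Proof.
by apply: (continuous_max0 (f := W^~ w)); exact: fbm_continuous W_fbm w.
Qed.

Lemma continuous_drifted c u w : continuous (fun t : R => drifted_fbm c u (Num.max 0 t) w).
Proof.
move=> t; apply: cvgB; apply: cvgM; try exact: cvg_cst.
  exact: continuous_path.
apply: (continuous_max (f := cst 0 : R -> R^o) (g := idfun)).
  exact: cvg_cst.
exact: cvg_id.
Qed.

Lemma within_drifted c u x t w :
  {within `[0, t], continuous (fun s => x + drifted_fbm c u s w)}.
Proof.
apply: (@subspace_eq_continuous _ `[0, t]%classic R (fun s : R => x + drifted_fbm c u (Num.max 0 s) w)).
  move=> s; rewrite inE/= in_itv/= => /andP[s0 _].
  by rewrite (max_idPr s0).
apply: continuous_subspaceT => s; apply: cvgD; first exact: cvg_cst.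
exact: continuous_drifted.
Qed.

Lemma within_drifted0 c u t w : {within `[0, t], continuous (drifted_fbm c u ^~ w)}.
Proof.
rewrite (_ : drifted_fbm c u ^~ w = fun s => 0 + drifted_fbm c u s w).
  exact: within_drifted.
by apply/funext => s; rewrite add0r.
Qed.

Lemma drifted0 c u w : drifted_fbm c u 0 w = 0.
Proof. by rewrite /drifted_fbm (fbm_start W_fbm) !mulr0 subrr. Qed.

(** The state is the larger of [x + Y t] and the maximum of the [Y t - Y s].
    Written as a conjunction of inequalities, this becomes an orthant once [s]
    is restricted to dense times. *)
Lemma le_state sigma x u t w y : 0 <= t ->
  state W sigma x u t w <= y <->
  x + drifted_fbm (sigma u) u t w <= y /\
  forall s, 0 <= s <= t -> drifted_fbm (sigma u) u t w - drifted_fbm (sigma u) u s w <= y.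
Proof.
move=> t0.
have netE s : netput W sigma x u s w = x + drifted_fbm (sigma u) u s w.
  by rewrite /netput /drifted_fbm; ring.
rewrite /state /regulator netE.
under [X in inf X]eq_imagel do rewrite netE.
rewrite lerBlDr -lerBlDl le_min; split.
  move=> /andP[h1 /(le_inf_itv _ (@within_drifted (sigma u) u x t w) t0) h2].
  split; first by lra.
  by move=> s st; have := h2 s st; lra.
move=> [h1 h2]; apply/andP; split; first by lra.
apply/(le_inf_itv _ (@within_drifted (sigma u) u x t w) t0) => s st.
by have := h2 s st; lra.
Qed.

Lemma le_reflected_dual c u x t w y : 0 <= t ->
  reflected_dual c u x t w <= y <->
  x + drifted_fbm c u t w <= y /\ forall s, 0 <= s <= t -> drifted_fbm c u s w <= y.
Proof.
move=> t0; rewrite /reflected_dual ge_max; split.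
  by move=> /andP[-> /(sup_itv_le _ (@within_drifted0 c u t w) t0)].
by move=> [-> /(sup_itv_le _ (@within_drifted0 c u t w) t0)].
Qed.

Lemma measurable_W (t : R) : measurable_fun setT (W t).
Proof. exact: measurable_funPT. Qed.

Lemma measurable_drifted d' (T : measurableType d') c u (tau : T -> R) (om : T -> Omega) :
  measurable_fun setT tau -> measurable_fun setT om -> (forall z, 0 <= tau z) ->
  measurable_fun setT (fun z => drifted_fbm c u (tau z) (om z)).
Proof.
move=> mtau mom tau0; apply: measurable_funB; last exact: measurable_funM.
apply: measurable_funM => //.
apply: (measurable_joint (W := fun t => W t : Omega -> R)) => //.
exact: continuous_path.
Qed.

(** It suffices to impose the inequalities of [le_state] at the countably many
    times [min (dense_time k) tau]. *)
Lemma measurable_state d' (T : measurableType d') sigma x u (tau : T -> R)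
    (om : T -> Omega) :
  measurable_fun setT tau -> measurable_fun setT om -> (forall z, 0 <= tau z) ->
  measurable_fun setT (fun z => state W sigma x u (tau z) (om z)).
Proof.
move=> mtau mom tau0; apply: measurable_fun_sublevel => y.
pose D := drifted_fbm (sigma u) u.
pose r k z := Num.min (dense_time R k) (tau z).
have r0 k z : 0 <= r k z <= tau z by exact: min_dense_time.
have mr k : measurable_fun setT (r k) by exact: measurable_minr.
rewrite (_ : [set z | _] = [set z | x + D (tau z) (om z) <= y] `&`
   \bigcap_k [set z | D (tau z) (om z) - D (r k z) (om z) <= y]).
  apply: measurableI.
    by apply: measurable_sublevel; apply: measurable_funD => //; exact: measurable_drifted.
  apply: bigcap_measurable => // k _; apply: measurable_sublevel.
  apply: measurable_funB; apply: measurable_drifted => //.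
  by move=> z; case/andP: (r0 k z).
apply/seteqP; split => z /=.
  move=> /(le_state _ _ _ _ _ (tau0 z))[h1 h2]; split => // k _.
  exact: h2.
move=> [h1 h2]; apply/le_state => //; split => // s /[dup] st /andP[s0 _].
have max0 (a : R) : 0 <= a -> Num.max 0 a = a by move=> ?; apply/max_idPr.
rewrite -[in drifted_fbm (sigma u) u s _](max0 _ s0).
apply: (le_dense_times_itv (g := fun a : R => D (tau z) (om z) - D (Num.max 0 a) (om z)) _ (tau0 z) _ st).
  by move=> a; apply: cvgB; [exact: cvg_cst|exact: continuous_drifted].
move=> k; have /andP[rk0 _] := r0 k z; rewrite (max0 _ rk0); exact: (h2 k I).
Qed.

Lemma measurable_drifted_at c u t : 0 <= t -> measurable_fun setT (drifted_fbm c u t).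
Proof.
move=> t0; apply: measurable_funB; last exact: measurable_cst.
by apply: measurable_funM => //; exact: measurable_W.
Qed.

(** The factor [a] serves to compare two processes whose times differ by a
    scaling. *)
Lemma below_ray_dense c u a y w : 0 < a ->
  (forall s, 0 <= s -> drifted_fbm c u s w <= y) <->
  (forall k, drifted_fbm c u (a * dense_time R k) w <= y).
Proof.
move=> a0; split => [h k|h s s0].
  by apply: h; rewrite mulr_ge0 ?dense_time_ge0// ltW.
have max0 (b : R) : 0 <= b -> Num.max 0 b = b by move=> ?; apply/max_idPr.
have := @le_dense_times _ (fun b : R => drifted_fbm c u (Num.max 0 (a * b)) w) y.
rewrite -[in drifted_fbm c u s _](divfK (lt0r_neq0 a0) s) mulrC.
have as0 : 0 <= s / a by rewrite divr_ge0// ltW.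
move=> /(_ _ _ _ as0); rewrite max0; last by rewrite mulr_ge0// ltW.
apply; last by move=> k; rewrite max0 ?mulr_ge0 ?dense_time_ge0// ltW.
move=> b; apply: (continuous_comp (f := fun b : R => a * b)
  (g := fun t : R => drifted_fbm c u (Num.max 0 t) w)).
  by apply: cvgM; [exact: cvg_cst|exact: cvg_id].
exact: continuous_drifted.
Qed.

Lemma measurable_below_ray c u y :
  measurable [set w | forall s, 0 <= s -> drifted_fbm c u s w <= y].
Proof.
rewrite (_ : [set w | _] = \bigcap_k [set w | drifted_fbm c u (1 * dense_time R k) w <= y]).
  apply: bigcap_measurable => // k _; apply: measurable_sublevel.
  by apply: measurable_drifted_at; rewrite mul1r dense_time_ge0.
apply/seteqP; split => w /=.
  by move=> h k _; exact: (below_ray_dense c u y w (@ltr01 R)).1.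
by move=> h; apply/(below_ray_dense c u y w (@ltr01 R)) => k; exact: h.
Qed.

Lemma bounded_eventE c u :
  [set w | bounded_above (drifted_fbm c u ^~ w)] =
  \bigcup_(n : nat) [set w | forall s, 0 <= s -> drifted_fbm c u s w <= n%:R].
Proof.
apply/seteqP; split => w /=.
  move=> [y hy]; exists (Num.truncn `|y|).+1 => //= s s0.
  apply: le_trans (hy s s0) _; apply: le_trans (ler_norm y) _.
  by have /andP[_ /ltW] := truncn_itv (normr_ge0 y).
by move=> [n _ hn]; exists n%:R.
Qed.

Lemma measurable_bounded_event c u :
  measurable [set w | bounded_above (drifted_fbm c u ^~ w)].
Proof.
by rewrite bounded_eventE; apply: bigcup_measurable => n _; exact: measurable_below_ray.
Qed.

Lemma peak_ge0 c u w : 0 <= fbm_peak c u w.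
Proof. by apply: sup_ray_ge0; exact: drifted0. Qed.

(** Paths that are not bounded above contribute too, their supremum being 0 by
    convention. *)
Lemma peak_sublevel c u y : 0 <= y ->
  [set w | fbm_peak c u w <= y] =
  [set w | forall s, 0 <= s -> drifted_fbm c u s w <= y] `|`
  ~` [set w | bounded_above (drifted_fbm c u ^~ w)].
Proof.
move=> y0; apply/seteqP; split => w /=.
  move=> py; case: (pselect (bounded_above (drifted_fbm c u ^~ w))) => [bw|]; last by right.
  by left => s s0; apply: le_trans py; exact: (le_sup_ray bw s0).
move=> [hy|nb]; first exact: sup_ray_le.
by rewrite /fbm_peak sup_ray_unbounded.
Qed.

Lemma measurable_peak c u : measurable_fun setT (fbm_peak c u).
Proof.
apply: measurable_fun_sublevel => y; have [y0|y0] := leP 0 y.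
  rewrite peak_sublevel//; apply: measurableU; first exact: measurable_below_ray.
  by apply: measurableC; exact: measurable_bounded_event.
rewrite (_ : [set w | _] = set0)//; apply/seteqP; split => w //=.
by move=> py; have := peak_ge0 c u w; lra.
Qed.

Lemma measurable_reflected_dual c u x t : 0 <= t ->
  measurable_fun setT (reflected_dual c u x t).
Proof.
move=> t0; apply: measurable_fun_sublevel => y.
have r0 k : 0 <= Num.min (dense_time R k) t <= t by exact: min_dense_time.
rewrite (_ : [set w | _] = [set w | x + drifted_fbm c u t w <= y] `&`
   \bigcap_k [set w | drifted_fbm c u (Num.min (dense_time R k) t) w <= y]).
  apply: measurableI.
    by apply: measurable_sublevel; apply: measurable_funD => //; exact: measurable_drifted_at.
  apply: bigcap_measurable => // k _; apply: measurable_sublevel; apply: measurable_drifted_at.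
  by case/andP: (r0 k).
apply/seteqP; split => w /=.
  move=> /(le_reflected_dual _ _ _ _ _ t0)[h1 h2]; split => // k _.
  exact: h2.
move=> [h1 h2]; apply/le_reflected_dual => //; split => // s /[dup] st /andP[s0 _].
have max0 (a : R) : 0 <= a -> Num.max 0 a = a by move=> ?; apply/max_idPr.
rewrite -[in drifted_fbm c u s _](max0 _ s0).
apply: (le_dense_times_itv (g := fun a : R => drifted_fbm c u (Num.max 0 a) w) _ t0 _ st).
  exact: continuous_drifted.
by move=> k; have /andP[rk0 _] := r0 k; rewrite (max0 _ rk0); exact: (h2 k I).
Qed.

End drifted_process.

(** * Reversal, self-similarity and finiteness of the maximum *)
Section fbm_laws.
Context d (Omega : measurableType d) (R : realType) (P : probability Omega R).
Variables (H : R) (W : R -> {RV P >-> R}).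
Hypothesis H_range : 2^-1 <= H < 1.
Hypothesis W_fbm : fractional_brownian_motion H W.
Implicit Types (c u v x y t : R) (w : Omega).
Local Notation drifted := (drifted_fbm W).
Local Notation peak := (fbm_peak W).
Local Notation reflected_dual := (reflected_dual W).

(** Both events are orthants for countable families: the increments
    [W t - W (t - r)] on the left, the values [W r] on the right.  The two
    families have the same covariance by [inner_reversed]. *)
Lemma state_sublevel_prob sigma x u t y : 0 < sigma u -> 0 <= t ->
  P [set w | state W sigma x u t w <= y] =
  P [set w | reflected_dual (sigma u) u x t w <= y].
Proof.
set c := sigma u => c0 t0.
(* index 0 is for the inequality at time [t] that involves the starting
   point [x]; on the left it is the increment over all of [[0, t]], as
   [W 0 = 0] *)
pose r k := if k is k'.+1 then Num.min (dense_time R k') t else t.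
have rt k : 0 <= r k <= t.
  by case: k => [|k] /=; [rewrite t0 lexx|exact: min_dense_time].
have max0 (a : R) : 0 <= a -> Num.max 0 a = a by move=> ?; apply/max_idPr.
pose b k := if k is k'.+1 then (y + u * r k) / c else (y - x + u * t) / c.
have -> : [set w | state W sigma x u t w <= y] =
    [set w | forall k, W t w - W (t - r k) w <= b k].
  have bP k w : (W t w - W (t - r k.+1) w <= b k.+1) =
      (drifted c u t w - drifted c u (t - r k.+1) w <= y).
    by rewrite /b ler_pdivlMr// /drifted; apply/idP/idP => ?; lra.
  have b0P w : (W t w - W (t - r 0%N) w <= b 0%N) = (x + drifted c u t w <= y).
    rewrite /= subrr (fbm_start W_fbm) subr0 ler_pdivlMr// /drifted.
    by apply/idP/idP => ?; lra.
  apply/seteqP; split => w /=.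
    move=> /(le_state W_fbm _ _ _ _ _ t0)[h1 h2] [|k]; first by rewrite b0P.
    by rewrite bP; apply: h2; have /andP[h3 h4] := rt k.+1; apply/andP; split; lra.
  move=> h; apply/(le_state W_fbm) => //; split; first by rewrite -b0P; exact: h.
  move=> s /andP[s0 st].
  have st' : 0 <= t - s <= t by apply/andP; split; lra.
  have := le_dense_times_itv (y := y) (g := fun a : R => drifted c u t w -
    drifted c u (Num.max 0 (t - a)) w) _ t0 _ st'.
  rewrite subKr max0//; apply.
    move=> a; apply: cvgB; first exact: cvg_cst.
    apply: (continuous_comp (f := fun a : R => t - a)
      (g := fun a : R => drifted c u (Num.max 0 a) w)).
      by apply: cvgB; [exact: cvg_cst|exact: cvg_id].
    exact: (continuous_drifted W_fbm).
  move=> k; have := h k.+1; rewrite bP max0//.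
  by have /andP[_ ?] := rt k.+1; rewrite subr_ge0.
have -> : [set w | reflected_dual c u x t w <= y] =
    [set w | forall k, W (r k) w <= b k].
  have bP k w : (W (r k.+1) w <= b k.+1) = (drifted c u (r k.+1) w <= y).
    by rewrite /b ler_pdivlMr// /drifted; apply/idP/idP => ?; lra.
  have b0P w : (W (r 0%N) w <= b 0%N) = (x + drifted c u t w <= y).
    by rewrite /= ler_pdivlMr// /drifted; apply/idP/idP => ?; lra.
  apply/seteqP; split => w /=.
    move=> /(le_reflected_dual W_fbm _ _ _ _ _ t0)[h1 h2] [|k]; first by rewrite b0P.
    by rewrite bP; apply: h2.
  move=> h; apply/(le_reflected_dual W_fbm) => //; split; first by rewrite -b0P; exact: h.
  move=> s /[dup] st /andP[s0 _].
  have := le_dense_times_itv (y := y) (g := fun a : R =>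
    drifted c u (Num.max 0 a) w) _ t0 _ st.
  rewrite max0//; apply; first exact: (continuous_drifted W_fbm).
  by move=> k; have := h k.+1; rewrite bP max0//; have /andP[] := rt k.+1.
apply: (gaussian_orthants W_fbm).
- move=> k; have /andP[? ?] := rt k; apply: spanB; apply: span_W => //; lra.
- by move=> k; have /andP[? ?] := rt k; apply: span_W.
- by move=> i j; apply: (inner_reversed H_range W_fbm).
Qed.

Lemma state_same_law sigma x u t : 0 < sigma u -> 0 <= t ->
  same_law P (state W sigma x u t) (reflected_dual (sigma u) u x t).
Proof.
move=> c0 t0; apply: same_law_cdf.
- apply: (measurable_state W_fbm sigma x u (tau := fun=> t) (om := idfun)) => //; exact: measurable_id.
- exact: (measurable_reflected_dual W_fbm).
- by move=> y; exact: state_sublevel_prob.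
Qed.

(** The control is the chaining series, with [N] as large as [q] and [H]
    require; such an [N] exists because [H < 1]. *)
Lemma supremum_control v q : 0 < v -> exists S : Omega -> \bar R,
  [/\ measurable_fun setT S, (forall w, 0 <= S w)%E,
      (\int[P]_w S w < +oo)%E &
      forall w y, 1 <= y -> (S w <= (y ^+ q)%:E)%E ->
        forall t, 0 <= t -> W t w - v * t <= y].
Proof.
move=> v0; have /andP[h1 h2] := H_range.
pose z : R := (q%:R + 2) / (1 - H).
pose N := (6 + q + (Num.truncn z).+1)%N.
have N6 : (6 <= N)%N by rewrite /N -addnA leq_addr.
have qN : (q <= 2 * N)%N by rewrite /N; lia.
have H1 : 0 < 1 - H by lra.
have qNH : q%:R + 2 <= (2 * N)%:R * (1 - H).
  rewrite -ler_pdivrMr// -/z.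
  have z0 : 0 <= z by rewrite divr_ge0 ?(ltW H1)// addr_ge0.
  have /andP[_ /ltW zN] := truncn_itv z0; apply: le_trans zN _.
  by rewrite ler_nat /N; lia.
exists (chaining_series W v q N); split.
- exact: measurable_chaining_series.
- exact: chaining_series_ge0.
- exact: (chaining_series_integrable H_range W_fbm).
- by move=> w y; exact: (chaining_series_bound W_fbm).
Qed.

(** A variable of finite expectation is almost surely finite, and where the
    control [S] is finite the path is bounded above. *)
Lemma ae_bounded_above c u : 0 < c -> 0 < u ->
  P (~` [set w | bounded_above (drifted c u ^~ w)]) = 0%E.
Proof.
move=> c0 u0; have v0 : 0 < u / c by rewrite divr_gt0.
have [S [mS S0 Soo SP]] := supremum_control 1 v0.
have iS : P.-integrable setT S.
  by apply/integrableP; split => //; under eq_integral do rewrite gee0_abs//.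
have [A [mA PA subA]] := integrable_ae measurableT iS.
apply/eqP; rewrite eq_le measure_ge0 andbT -PA.
apply: le_measure; rewrite ?inE//.
  by apply: measurableC; exact: (measurable_bounded_event W_fbm).
move=> w /= nb; apply: subA => /= /(_ I) Sfin; apply: nb.
pose y := 1 + fine (S w).
have fS0 : 0 <= fine (S w) by rewrite fine_ge0.
exists (c * y) => s s0; rewrite /drifted.
have : W s w - u / c * s <= y.
  apply: (SP w y _ _ s s0); first by rewrite /y; lra.
  by rewrite expr1 -[leLHS]fineK// lee_fin /y; lra.
rewrite -(ler_pM2l c0) mulrBr mulrA mulrCA divff ?mulr1//; last by rewrite gt_eqF.
Qed.

Lemma peak_moment c u q : 0 < c -> 0 < u -> (0 < q)%N ->
  (\int[P]_w (peak c u w ^+ q)%:E < +oo)%E.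
Proof.
move=> c0 u0 q0; have v0 : 0 < u / c by rewrite divr_gt0.
have [S [mS S0 Soo SP]] := supremum_control q v0.
have mp := measurable_peak W_fbm c u.
apply: (@le_lt_trans _ _ (\int[P]_w ((c ^+ q)%:E * (1 + S w)))%E).
  apply: ge0_le_integral => //.
  - by move=> w _; rewrite lee_fin exprn_ge0// (peak_ge0 W_fbm).
  - by apply/measurable_EFinP; apply: measurable_funX.
  - by apply: measurable_funeM; apply: emeasurable_funD.
  move=> w _; have [Sfin|] := boolP (S w \is a fin_num); last first.
    rewrite ge0_fin_numE// -leNgt leye_eq => /eqP ->.
    by rewrite addey// gt0_muley ?leey// lte_fin exprn_gt0.
  pose s := fine (S w); have s0 : 0 <= s by rewrite fine_ge0.
  have -> : S w = s%:E by rewrite /s fineK.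
  (* the control at [w] is used with [y ^ q = 1 + S w], which makes [y >= 1] *)
  pose y := (1 + s) `^ (q%:R^-1).
  have yq : y ^+ q = 1 + s.
    rewrite -powR_mulrn ?powR_ge0// -powRrM mulVf ?powRr1 ?pnatr_eq0 -?lt0n//.
    by rewrite addr_ge0.
  have y1 : 1 <= y.
    rewrite -[leLHS](powRr0 (1 + s)); apply: ler_powR; first by lra.
    by rewrite invr_ge0.
  have y0 : 0 <= y by lra.
  rewrite -EFinD -EFinM lee_fin -yq -exprMn.
  apply: lerXn2r; rewrite ?nnegrE ?(peak_ge0 W_fbm)//.
    by rewrite mulr_ge0// ltW.
  apply: sup_ray_le => r r0; rewrite /drifted.
  have : W r w - u / c * r <= y.
    apply: (SP w y y1 _ r r0).
    by rewrite yq -[leLHS]fineK// lee_fin -/s; lra.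
  by rewrite -(ler_pM2l c0) mulrBr mulrA mulrCA divff ?mulr1// gt_eqF.
rewrite ge0_integralZl//; last 3 first.
- by apply: emeasurable_funD.
- by move=> w _; rewrite adde_ge0.
- by rewrite lee_fin exprn_ge0// ltW.
rewrite ge0_integralD//.
rewrite integral_cst// mul1e lte_mul_pinfty ?lee_fin ?exprn_ge0 ?(ltW c0)//.
by apply: lte_add_pinfty => //; rewrite -ge0_fin_numE// fin_num_measure.
Qed.

(** With [c a^H = 1] the family [c W (a t)] has the covariance of [W t], and
    the drift over time [a t] is [u a t]. *)
Lemma ray_prob_scaled c u y : 0 < c -> 0 < u ->
  P [set w | forall s, 0 <= s -> drifted c u s w <= y] =
  P [set w | forall s, 0 <= s -> drifted 1 (u / c `^ H^-1) s w <= y].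
Proof.
move=> c0 u0; have /andP[h1 h2] := H_range.
(* the time change a with c * a ^ H = 1 *)
pose a := c `^ (- H^-1).
have a0 : 0 < a by rewrite powR_gt0.
have H0 : H != 0 by rewrite gt_eqF//; lra.
have caH : c ^+ 2 * a `^ (2 * H) = 1.
  rewrite -powRrM mulNr mulrCA mulVf// mulr1 -powR_mulrn ?(ltW c0)//.
  by rewrite powRN mulfV// gt_eqF// powR_gt0.
have vE : u / c `^ H^-1 = u * a by rewrite /a powRN.
pose t k := dense_time R k.
have t0 k : 0 <= t k by exact: dense_time_ge0.
pose b k := y + u * a * t k.
have -> : [set w | forall s, 0 <= s -> drifted c u s w <= y] =
    [set w | forall k, c * W (a * t k) w <= b k].
  apply/seteqP; split => w /=.
    move=> /(below_ray_dense W_fbm c u y w a0) h k.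
    by have := h k; rewrite /drifted /b -/(t k); lra.
  move=> h; apply/(below_ray_dense W_fbm c u y w a0) => k.
  by have := h k; rewrite /drifted /b -/(t k); lra.
have -> : [set w | forall s, 0 <= s -> drifted 1 (u / c `^ H^-1) s w <= y] =
    [set w | forall k, W (t k) w <= b k].
  rewrite vE; apply/seteqP; split => w /=.
    move=> /(below_ray_dense W_fbm _ _ y w (@ltr01 R)) h k.
    by have := h k; rewrite /drifted /b !mul1r -/(t k); lra.
  move=> h; apply/(below_ray_dense W_fbm _ _ y w (@ltr01 R)) => k.
  by have := h k; rewrite /drifted /b !mul1r -/(t k); lra.
apply: (gaussian_orthants W_fbm).
- by move=> k; apply: spanZ; apply: span_W; rewrite mulr_ge0// ltW.
- by move=> k; apply: span_W.
- by move=> i j; apply: (inner_scaled W_fbm).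
Qed.

Lemma peak_sublevel_prob c u y : 0 < c -> 0 < u -> 0 <= y ->
  P [set w | peak c u w <= y] =
  P [set w | forall s, 0 <= s -> drifted c u s w <= y].
Proof.
move=> c0 u0 y0; rewrite peak_sublevel//.
have mA := measurable_below_ray W_fbm c u y.
have mB := measurableC (measurable_bounded_event W_fbm c u).
apply/eqP; rewrite eq_le; apply/andP; split.
  apply: le_trans (measureU2 _ mA mB) _.
  by rewrite [X in (_ + X)%E](ae_bounded_above c0 u0) adde0.
by apply: le_measure; rewrite ?inE//; exact: measurableU.
Qed.

Lemma peak_same_law c u : 0 < c -> 0 < u ->
  same_law P (peak c u) (peak 1 (u / c `^ H^-1)).
Proof.
move=> c0 u0; have v0 : 0 < u / c `^ H^-1 by rewrite divr_gt0// powR_gt0.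
apply: same_law_cdf; [exact: (measurable_peak W_fbm)|exact: (measurable_peak W_fbm)|].
move=> y; have [y0|y0] := leP 0 y.
  by rewrite !peak_sublevel_prob// ray_prob_scaled.
have neg u' c' : [set w | peak c' u' w <= y] = set0.
  apply/seteqP; split => w //= py; have := peak_ge0 W_fbm c' u' w; lra.
by rewrite !neg.
Qed.

Lemma all_time_maxE v : all_time_max W v = peak 1 v.
Proof.
apply/funext => w; rewrite /all_time_max /fbm_peak; congr sup.
by apply: eq_imagel => s _; rewrite /drifted_fbm mul1r.
Qed.

End fbm_laws.

(** * Convergence of expectations *)
Section limit_expectation.
Context d (Omega : measurableType d) (R : realType) (P : probability Omega R).
Variables (H : R) (W : R -> {RV P >-> R}) (sigma : R -> R) (u x : R).
Hypothesis H_range : 2^-1 <= H < 1.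
Hypothesis W_fbm : fractional_brownian_motion H W.
Hypotheses (u0 : 0 < u) (x0 : 0 <= x) (sigma0 : 0 < sigma u).
Let c := sigma u.
Let c0 : 0 < c := sigma0.
Local Notation drifted := (drifted_fbm W).
Local Notation peak := (fbm_peak W c u).
Local Notation dual := (reflected_dual W c u x).
Local Notation state := (state W sigma x u).

Variables (F : R -> R) (K : R) (q : nat).
Hypothesis cF : continuous F.
Hypothesis F0 : forall y, 0 <= F y.
Hypothesis ndF : {homo F : y z / y <= z}.
Hypothesis q0 : (0 < q)%N.
Hypothesis FK : forall y, 0 <= y -> F y <= K * (1 + y ^+ q).

Let mF : measurable_fun setT F := continuous_measurable_fun cF.

Lemma binomial_power_le (y : R) : 0 <= y -> (1 + y) ^+ q <= 2 ^+ q * (1 + y ^+ q).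
Proof.
move=> y0; have [y1|/ltW y1] := leP y 1.
  apply: (@le_trans _ _ (2 ^+ q)); first by apply: lerXn2r; rewrite ?nnegrE; lra.
  by rewrite ler_peMr ?exprn_ge0// lerDl exprn_ge0.
apply: (@le_trans _ _ ((2 * y) ^+ q)); first by apply: lerXn2r; rewrite ?nnegrE; lra.
by rewrite exprMn ler_wpM2l ?exprn_ge0// lerDr.
Qed.

(** The growth condition and
    [(1 + x + Z)^q <= (1 + x)^q (1 + Z)^q] reduce this to the moment of order
    [q] of the maximum [Z]. *)
Lemma dominating_integrable :
  P.-integrable setT (fun w => (F (x + peak w))%:E).
Proof.
have mp : measurable_fun setT peak by exact: (measurable_peak W_fbm).
have K0 : 0 <= K by have := FK (lexx 0); rewrite expr0n gtn_eqF// addr0 mulr1; exact: le_trans.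
pose B := K * (1 + (1 + x) ^+ q * 2 ^+ q).
have B0 : 0 <= B.
  by rewrite (mulr_ge0 K0)// addr_ge0// mulr_ge0// exprn_ge0// addr_ge0.
have ip : P.-integrable setT (fun w => (B * (1 + peak w ^+ q))%:E).
  under eq_fun do rewrite EFinM EFinD; apply: integrableZl => //.
  apply: integrableD => //.
    exact: (@bounded_integrable _ _ _ _ (cst 1) `|1|).
  apply/integrableP; split.
    by apply/measurable_EFinP; exact: measurable_funX.
  under eq_integral do rewrite gee0_abs ?lee_fin ?exprn_ge0 ?(peak_ge0 W_fbm)//.
  exact: (peak_moment H_range W_fbm).
apply: le_integrable ip => //.
  apply/measurable_EFinP; apply: (measurableT_comp mF).
  exact: measurable_funD.
move=> w _; have p0 : 0 <= peak w by exact: (peak_ge0 W_fbm).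
rewrite /= lee_fin ger0_norm// ger0_norm; last by rewrite mulr_ge0// addr_ge0// exprn_ge0.
apply: le_trans (FK (addr_ge0 x0 p0)) _.
rewrite /B -mulrA ler_wpM2l// mulrDl mul1r lerD//.
  by rewrite lerDl exprn_ge0.
apply: (@le_trans _ _ (((1 + x) * (1 + peak w)) ^+ q)).
  apply: lerXn2r; rewrite ?nnegrE ?addr_ge0// ?mulr_ge0 ?addr_ge0//.
  by have := mulr_ge0 x0 p0; lra.
rewrite exprMn -mulrA ler_wpM2l ?exprn_ge0 ?addr_ge0//.
exact: binomial_power_le.
Qed.

Lemma dual_le_peak t w : 0 <= t -> bounded_above (drifted c u ^~ w) ->
  dual t w <= x + peak w.
Proof.
move=> t0 bw; apply/(le_reflected_dual W_fbm) => //; split.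
  by rewrite lerD2l; exact: (le_sup_ray bw t0).
move=> s /andP[s0 _]; apply: le_trans (le_sup_ray bw s0) _.
by rewrite lerDr.
Qed.

Lemma dual_ge t s w : 0 <= s <= t -> drifted c u s w <= dual t w.
Proof.
move=> st; have t0 : 0 <= t by case/andP: st => ? ?; lra.
by have [_] := (le_reflected_dual W_fbm c u x w (dual t w) t0).1 (lexx _); apply.
Qed.

(** The maximum of the path over [[0, t]] increases to its supremum.  Boundedness
    with the smaller drift [u / 2] gives [x + Y t <= x + b - (u / 2) t], so the
    other term is eventually at most [0], hence below the peak. *)
Lemma dual_cvg w (tau : nat -> R) :
  bounded_above (drifted c u ^~ w) -> bounded_above (drifted c (u / 2) ^~ w) ->
  (forall n, 0 <= tau n) -> tau n @[n --> \oo] --> +oo ->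
  dual (tau n) w @[n --> \oo] --> peak w.
Proof.
move=> bw [b hb] tau0 /cvgryPge tauy; apply/cvgrPdist_le => e e0.
have has_sup_peak : has_sup [set drifted c u s w | s in `[0, +oo[].
  split; first by exists (drifted c u 0 w), 0; rewrite //= in_itv/= lexx.
  have [y hy] := bw; exists y => _ /= [r + <-].
  by rewrite in_itv/= andbT; exact: hy.
have [_ [s + <-] es] := sup_adherent e0 has_sup_peak.
rewrite /= in_itv/= andbT => s0.
near=> n.
have sn : s <= tau n by near: n; exact: tauy.
have bn : 2 * (x + b) / u <= tau n by near: n; exact: tauy.
have h1 : drifted c u s w <= dual (tau n) w by apply: dual_ge; rewrite s0.
have h2 : dual (tau n) w <= peak w.
  apply/(le_reflected_dual W_fbm) => //; split.
    have h3 := hb (tau n) (tau0 n); have := peak_ge0 W_fbm c u w.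
    move: bn; rewrite ler_pdivrMr//; move: h3; rewrite /drifted_fbm; lra.
  by move=> r /andP[r0 _]; exact: (le_sup_ray bw r0).
rewrite ger0_norm ?subr_ge0//; move: es; rewrite -/(fbm_peak W c u w); lra.
Unshelve. all: by end_near. Qed.

Definition state_mean t : R := \int[P]_w F (state t w).

Lemma state_expectation t : 0 <= t ->
  (\int[P]_w (F (state t w))%:E = \int[P]_w (F (dual t w))%:E)%E.
Proof.
move=> t0; apply: ge0_expectation_same_law => //.
- apply: (measurable_state W_fbm sigma x u (tau := fun=> t) (om := idfun)) => //; exact: measurable_id.
- exact: (measurable_reflected_dual W_fbm).
- exact: (state_same_law H_range W_fbm).
Qed.

Let ae_bounded : {ae P, forall w, bounded_above (drifted c u ^~ w) /\
  bounded_above (drifted c (u / 2) ^~ w)}.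
Proof.
have v0 : 0 < u / 2 by rewrite divr_gt0.
exists (~` [set w | bounded_above (drifted c u ^~ w)] `|`
        ~` [set w | bounded_above (drifted c (u / 2) ^~ w)]); split.
- by apply: measurableU; apply: measurableC; exact: (measurable_bounded_event W_fbm).
- apply: null_set_setU; try (by apply: measurableC; exact: (measurable_bounded_event W_fbm)).
    exact: (ae_bounded_above H_range W_fbm).
  exact: (ae_bounded_above H_range W_fbm).
- by move=> w /= /not_andP.
Qed.

Let ae_dominated t : 0 <= t ->
  {ae P, forall w, setT w -> (`|(F (dual t w))%:E| <= (F (x + peak w))%:E)%E}.
Proof.
move=> t0; apply: filterS ae_bounded => w [bw _] _.
by rewrite /= lee_fin ger0_norm// ndF// dual_le_peak.
Qed.

Let mFd t : 0 <= t -> measurable_fun setT (fun w => (F (dual t w))%:E).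
Proof.
move=> t0; apply/measurable_EFinP; apply: (measurableT_comp mF).
exact: (measurable_reflected_dual W_fbm).
Qed.

Let mFp : measurable_fun setT (fun w => (F (x + peak w))%:E).
Proof.
apply/measurable_EFinP; apply: (measurableT_comp mF).
by apply: measurable_funD => //; exact: (measurable_peak W_fbm).
Qed.

Lemma dual_expectation_le t : 0 <= t ->
  (\int[P]_w (F (dual t w))%:E <= \int[P]_w (F (x + peak w))%:E)%E.
Proof.
move=> t0; apply: ae_ge0_le_integral => //.
- by move=> w _; rewrite lee_fin.
- exact: mFd.
- by move=> w _; rewrite lee_fin.
- by apply: filterS (ae_dominated t0) => w h _; have := h I; rewrite gee0_abs ?lee_fin.
Qed.

Lemma state_meanE t : 0 <= t -> (\int[P]_w (F (state t w))%:E = (state_mean t)%:E)%E.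
Proof.
move=> t0; rewrite /state_mean /Rintegral fineK// state_expectation// ge0_fin_numE.
  apply: le_lt_trans (dual_expectation_le t0) _.
  rewrite -ge0_fin_numE; last by apply: integral_ge0 => w _; rewrite lee_fin.
  exact: integrable_fin_num dominating_integrable.
by apply: integral_ge0 => w _; rewrite lee_fin.
Qed.

Lemma state_mean_ge0 t : 0 <= state_mean t.
Proof. by apply: Rintegral_ge0. Qed.

Lemma state_mean_bounded t : 0 <= t -> state_mean t <= \int[P]_w F (x + peak w).
Proof.
move=> t0; rewrite -lee_fin -state_meanE// state_expectation//.
rewrite /Rintegral fineK; first exact: dual_expectation_le.
exact: integrable_fin_num dominating_integrable.
Qed.

(** The state is replaced by its dual, which has the same law at each time, and
    dominated convergence applies along every sequence of times. *)
Lemma state_mean_cvg :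
  state_mean t @[t --> +oo] --> \int[P]_w F (peak w).
Proof.
apply/cvg_pinftyP => tau tauy.
pose tau' n := Num.max 0 (tau n).
have tau'0 n : 0 <= tau' n by rewrite le_max lexx.
have tau'E : \forall n \near \oo, tau' n = tau n.
  by near=> n; apply/max_idPr; near: n; move/cvgryPge : tauy; exact.
have tau'y : tau' n @[n --> \oo] --> +oo.
  by apply: cvg_trans tauy; apply: near_eq_cvg; apply: filterS tau'E => n ->.
have mp : measurable_fun setT (fun w => (F (peak w))%:E).
  apply/measurable_EFinP; apply: (measurableT_comp mF).
  exact: (measurable_peak W_fbm).
have cvgF : {ae P, forall w, setT w ->
    (F (dual (tau' n) w))%:E @[n --> \oo] --> (F (peak w))%:E}.
  apply: filterS ae_bounded => w [b1 b2] _.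
  have : F (dual (tau' n) w) @[n --> \oo] --> F (peak w).
    by apply: (@continuous_cvg _ R R _ _ _ F); [exact: cF|exact: dual_cvg].
  by move=> Fcvg; apply: cvg_EFin Fcvg; near=> n.
have domF : {ae P, forall w, forall n, setT w ->
    (`|(F (dual (tau' n) w))%:E| <= (F (x + peak w))%:E)%E}.
  apply: filterS ae_bounded => w [bw _] n _.
  by rewrite /= lee_fin ger0_norm// ndF// dual_le_peak.
have [ip _ lim] := dominated_convergence measurableT (fun n => mFd (tau'0 n))
  mp cvgF dominating_integrable domF.
suff : state_mean (tau' n) @[n --> \oo] --> \int[P]_w F (peak w).
  apply: cvg_trans; apply: near_eq_cvg; apply: filterS tau'E => n ->.
  by [].
apply: fine_cvg; rewrite fineK; last exact: integrable_fin_num ip.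
have -> : (fun n => \int[P]_w (F (state (tau' n) w))%:E)%E =
    (fun n => \int[P]_w (F (dual (tau' n) w))%:E)%E.
  by apply/funext => n; rewrite state_expectation.
exact: lim.
Unshelve. all: by end_near. Qed.

End limit_expectation.

(** * Long-run averages *)
Lemma cvg_limf_esup (R : realType) (f : R -> \bar R) (l : R) :
  f t @[t --> +oo] --> l%:E -> limf_esup f +oo = l%:E.
Proof.
move=> fl; apply/eqP; rewrite eq_le; apply/andP; split.
  apply/lee_addgt0Pr => e e0; apply: ge_ereal_inf.
  have : \forall t \near +oo, (f t <= l%:E + e%:E)%E.
    have : nbhs (l%:E : \bar R) [set y | (y <= l%:E + e%:E)%E].
      exists e => //= r /=; rewrite ltr_distlC => /andP[_ h].
      by rewrite -EFinD lee_fin ltW.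
    by move/fl.
  move=> [M [Mr hM]]; exists (ereal_sup (f @` [set t | M < t])).
    by exists [set t | M < t] => //; exists M.
  by apply: ge_ereal_sup => _ [t Mt <-]; exact: hM.
apply: le_ereal_inf_tmp => _ [V nV <-].
apply/lee_subgt0Pr => e e0.
have : \forall t \near +oo, (l%:E - e%:E <= f t)%E.
  have : nbhs (l%:E : \bar R) [set y | (l%:E - e%:E <= y)%E].
    exists e => //= r /=; rewrite ltr_distlC => /andP[h _].
    by rewrite -EFinB lee_fin ltW.
  by move/fl.
move=> hN; have [t [Vt ht]] := filter_ex (filterI nV hN).
by apply: le_trans ht _; apply: ereal_sup_ubound; exists t.
Qed.

Lemma lebesgue_measure_itv0 (R : realType) (T : R) : 0 <= T ->
  (lebesgue_measure (`[0%R, T]%classic : set R) = T%:E)%E.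
Proof.
rewrite lebesgue_measure_itv/= lte_fin le_eqVlt => /predU1P[<-|T0].
  by rewrite ltxx.
by rewrite T0 -EFinB subr0.
Qed.

Section cesaro.
Variables (R : realType) (phi : R -> R) (B l : R).
Local Notation mu := (@lebesgue_measure R).
Hypothesis mphi : measurable_fun setT phi.
Hypothesis phiB : forall t, 0 <= t -> `|phi t| <= B.
Hypothesis phi_cvg : phi t @[t --> +oo] --> l.

Lemma bounded_integrable_itv (f : R -> R) (K T : R) : measurable_fun setT f ->
  (forall t, 0 <= t -> `|f t| <= K) -> 0 <= T ->
  mu.-integrable `[0, T] (EFin \o f).
Proof.
move=> mf fK T0; apply: measurable_bounded_integrable => //.
- by rewrite [X in (X < _)%E](lebesgue_measure_itv0 T0) ltry.
- exact: measurable_funTS.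
- exists K; split; first exact: num_real.
  move=> y Ky t /=; rewrite in_itv/= => /andP[t0 _].
  by rewrite (le_trans (fK t t0))// ltW.
Qed.

(** Beyond some [M] the function [phi] is within [e / 2] of [l], so on [[0, T]]
    [|l - phi|] is at most [e / 2] plus [D] times the indicator of [[0, M]], and
    the contribution [D M / T] of the latter vanishes. *)
Lemma cesaro_cvg :
  T^-1 * \int[mu]_(t in `[0, T]) phi t @[T --> +oo] --> l.
Proof.
apply/cvgrPdist_le => e e0.
have e20 : 0 < e / 2 by rewrite divr_gt0.
move/cvgrPdist_le : (phi_cvg) => /(_ _ e20) [M0 [_ hM0]].
pose M := Num.max 0 M0.
have M_ge0 : 0 <= M by rewrite le_max lexx.
pose D := B + `|l|.
have B0 : 0 <= B := le_trans (normr_ge0 _) (phiB (lexx 0)).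
have D0 : 0 <= D by rewrite addr_ge0.
near=> T.
have T0 : 0 < T by near: T; exact: nbhs_pinfty_gt.
have TD : 2 * (D * M) / e <= T by near: T; apply: nbhs_pinfty_ge; rewrite num_real.
have T0' := ltW T0.
have muT : fine (mu `[0, T]) = T.
  by rewrite [X in fine X](lebesgue_measure_itv0 T0').
have iphi : mu.-integrable `[0, T] (EFin \o phi).
  exact: bounded_integrable_itv mphi phiB T0'.
have icst (k : R) : mu.-integrable `[0, T] (EFin \o cst k).
  exact: (@bounded_integrable_itv _ `|k|).
have -> : l = T^-1 * \int[mu]_(t in `[0, T]) l.
  by rewrite Rintegral_cst// [X in _ * (_ * X)]muT mulrCA mulVf ?mulr1// gt_eqF.
rewrite -mulrBr -RintegralB//; last exact: (icst l).
rewrite normrM gtr0_norm ?invr_gt0// mulrC ler_pdivrMr//.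
have idiff : mu.-integrable `[0, T] (EFin \o (fun t => l - phi t)).
  apply: (@bounded_integrable_itv _ D) => //; first exact: measurable_funB.
  move=> t t0; apply: le_trans (ler_normB _ _) _; rewrite addrC lerD2r; exact: phiB.
apply: le_trans (le_normr_Rintegral _ idiff) _ => //.
have mind : measurable_fun setT (\1_`[0, M] : R -> R) by exact: measurable_indic.
have iind : mu.-integrable `[0, T] (EFin \o (\1_`[0, M] : R -> R)).
  apply: (@bounded_integrable_itv _ 1) => // t _.
  by rewrite indicE normr_nat lern1 leq_b1.
apply: (@le_trans _ _ (\int[mu]_(t in `[0, T]) (e / 2 + D * \1_`[0, M] t))).
  apply: le_Rintegral => //.
  - apply: (@bounded_integrable_itv _ D) => //.
      by apply: measurableT_comp => //; exact: measurable_funB.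
    move=> t t0; rewrite normr_id.
    by apply: le_trans (ler_normB _ _) _; rewrite addrC lerD2r; exact: phiB.
  - apply: (@bounded_integrable_itv _ (e / 2 + D)) => //.
      by apply: measurable_funD => //; exact: measurable_funM.
    move=> t t0; rewrite ger0_norm; last by rewrite addr_ge0 ?mulr_ge0// ltW.
    by rewrite lerD2l indicE ler_piMr// lern1 leq_b1.
  - move=> t /=; rewrite in_itv/= => /andP[t0 tT]; rewrite indicE.
    have [tM|tM] := leP t M.
      rewrite mem_set/=; last by rewrite in_itv/= t0.
      rewrite mulr1; apply: le_trans (ler_normB _ _) _.
      by have := phiB t0; rewrite /D; lra.
    rewrite memNset/=; last by rewrite in_itv/= t0/= leNgt tM.
    rewrite mulr0 addr0; apply: hM0.
    by apply: le_lt_trans tM; rewrite le_max lexx orbT.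
rewrite RintegralD//; last 2 first.
- exact: icst.
- apply: (@bounded_integrable_itv _ D) => //.
    exact: measurable_funM.
  move=> t t0; rewrite ger0_norm ?mulr_ge0//.
  by rewrite indicE ler_piMr// lern1 leq_b1.
rewrite Rintegral_cst// [X in _ * X + _]muT RintegralZl//.
have indM : \int[mu]_(t in `[0, T]) (\1_`[0, M] t : R) <= M.
  rewrite /Rintegral integral_indic// -lee_fin fineK.
    apply: (@le_trans _ _ (mu `[0, M])).
      by apply: le_measure; rewrite ?inE//; exact: measurableI.
    by rewrite [X in (X <= _)%E](lebesgue_measure_itv0 M_ge0).
  rewrite ge0_fin_numE//; apply: (@le_lt_trans _ _ (mu `[0, M])).
    by apply: le_measure; rewrite ?inE//; exact: measurableI.
  by rewrite [X in (X < _)%E](lebesgue_measure_itv0 M_ge0) ltry.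
have DM : D * \int[mu]_(t in `[0, T]) (\1_`[0, M] t : R) <= D * M by rewrite ler_wpM2l.
move: TD; rewrite ler_pdivrMr//; lra.
Unshelve. all: by end_near. Qed.

End cesaro.

(** * The long-run cost *)
Section long_run_cost.
Context d (Omega : measurableType d) (R : realType) (P : probability Omega R).
Variables (H : R) (W : R -> {RV P >-> R}) (sigma : R -> R) (u x : R).
Hypothesis H_range : 2^-1 <= H < 1.
Hypothesis W_fbm : fractional_brownian_motion H W.
Hypotheses (u0 : 0 < u) (x0 : 0 <= x) (sigma0 : 0 < sigma u).
Local Notation mu := (@lebesgue_measure R).
Local Notation state := (state W sigma x u).
Local Notation drifted := (drifted_fbm W (sigma u) u).
Local Notation peak := (fbm_peak W (sigma u) u).

Lemma state_ge0 t w : 0 <= t -> 0 <= state t w.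
Proof.
move=> t0; have [_ h] := (le_state W_fbm sigma x u w (state t w) t0).1 (lexx _).
by have := h t; rewrite subrr; apply; rewrite t0 lexx.
Qed.

Lemma state_bounded_itv T w : 0 <= T ->
  exists y, forall t, 0 <= t <= T -> state t w <= y.
Proof.
move=> T0; have cD : {within `[0, T], continuous (drifted ^~ w)} by exact: (within_drifted0 W_fbm).
have [a aT ha] := EVT_max T0 cD; have [b bT hb] := EVT_min T0 cD.
have DE : drifted 0 w = 0 by exact: (drifted0 W_fbm).
have zT : 0 \in `[0, T] by rewrite in_itv/= lexx.
have a0 : 0 <= drifted a w by rewrite -DE; exact: ha.
have b0 : drifted b w <= 0 by rewrite -DE; exact: hb.
exists (x + drifted a w - drifted b w) => t /andP[t0 tT].
have inT s : 0 <= s <= t -> s \in `[0, T].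
  by move=> /andP[s0 st]; rewrite in_itv/= s0 (le_trans st tT).
apply/(le_state W_fbm) => //; split.
  have /= := ha t (inT t _); rewrite t0 lexx => /(_ isT); lra.
move=> s st; have /= := ha t (inT t _); rewrite t0 lexx => /(_ isT).
have /= h1 := hb s (inT s st) => h2.
apply: le_trans (lerB h2 h1) _.
rewrite -[leRHS]addrA.
by rewrite lerDr.
Qed.

Section running_integral.
Variables (F : R -> R) (K : R) (q : nat).
Hypothesis cF : continuous F.
Hypothesis F0 : forall y, 0 <= F y.
Hypothesis ndF : {homo F : y z / y <= z}.
Hypothesis q0 : (0 < q)%N.
Hypothesis FK : forall y, 0 <= y -> F y <= K * (1 + y ^+ q).
Local Notation mean_at := (state_mean W sigma u x F).

Let mF : measurable_fun setT F := continuous_measurable_fun cF.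

(** The process is constrained at nonnegative times only; clamping the time
    gives a function on the whole product space to which Tonelli's theorem
    applies. *)
Let integrand T (z : Omega * measurableTypeR R) : \bar R :=
  (F (state (Num.max 0 z.2) z.1) * \1_(`[0, T] : set R) z.2)%:E.

Let m_tau : measurable_fun setT
  (fun z : Omega * measurableTypeR R => Num.max 0 (z.2 : R)).
Proof. by apply: measurable_maxr => //; exact: measurable_snd. Qed.

Let m_integrand T : measurable_fun setT (integrand T).
Proof.
apply/measurable_EFinP; apply: measurable_funM.
  apply: (measurableT_comp mF).
  apply: (measurable_state W_fbm sigma x u (tau := fun z : Omega * measurableTypeR R =>
     Num.max 0 (z.2 : R)) (om := fst)) => //.
  by move=> z; rewrite le_max lexx.
apply: (measurableT_comp (f := \1_(`[0, T] : set R) : R -> R)); first exact: measurable_indic.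
exact: measurable_snd.
Qed.

Let integrand_ge0 T z : (0 <= integrand T z)%E.
Proof. by rewrite lee_fin mulr_ge0. Qed.

Lemma running_integrable T w : 0 <= T ->
  mu.-integrable `[0, T] (fun t => (F (state t w))%:E).
Proof.
move=> T0; have [y hy] := state_bounded_itv w T0.
have ms : measurable_fun setT (fun t : R => F (state (Num.max 0 t) w)).
  apply: (measurableT_comp mF).
  apply: (measurable_state W_fbm sigma x u (tau := fun t : R => Num.max 0 t)
    (om := fun=> w)) => //; first exact: measurable_maxr.
  by move=> z; rewrite le_max lexx.
apply: (@eq_integrable _ _ _ mu _ _ (fun t => (F (state (Num.max 0 t) w))%:E)) => //.
  by move=> t; rewrite inE/= in_itv/= => /andP[t0 _]; rewrite (max_idPr t0).
apply: measurable_bounded_integrable => //.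
- by rewrite [X in (X < _)%E](lebesgue_measure_itv0 T0) ltry.
- exact: measurable_funTS.
- exists (F y); split; first exact: num_real.
  move=> z yz t /=; rewrite in_itv/= => /andP[t0 tT].
  rewrite (max_idPr t0) ger0_norm// (le_trans _ (ltW yz))// ndF// hy//.
  by rewrite t0.
Qed.

Let inner_integrand T w : 0 <= T ->
  (\int[mu]_t integrand T (w, t) = (\int[mu]_(t in `[0, T]) F (state t w))%:E)%E.
Proof.
move=> T0; rewrite /Rintegral fineK; last exact: integrable_fin_num (running_integrable w T0).
rewrite [RHS]integral_mkcond; apply: eq_integral => t _.
rewrite patchE /integrand /= indicE; case: ifPn => tT; last by rewrite mulr0.
move: tT; rewrite inE/= in_itv/= => /andP[t0 _].
by rewrite mulr1 (max_idPr t0).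
Qed.

Lemma measurable_running T : 0 <= T ->
  measurable_fun setT (fun w => \int[mu]_(t in `[0, T]) F (state t w)).
Proof.
move=> T0; apply/measurable_EFinP.
apply: (eq_measurable_fun (fun w => \int[mu]_t integrand T (w, t))%E).
  by move=> w _; rewrite inner_integrand.
exact: (@measurable_fun_fubini_tonelli_F _ _ Omega (measurableTypeR R) R mu (integrand T)).
Qed.

Lemma measurable_mean_at : measurable_fun setT (fun t : R => mean_at (Num.max 0 t)).
Proof.
apply/measurable_EFinP.
apply: (eq_measurable_fun (fun t : R => \int[P]_w (F (state (Num.max 0 t) w))%:E)%E).
  move=> t _; rewrite /= (state_meanE H_range W_fbm u0 x0 sigma0 cF F0 ndF q0 FK)//.
  by rewrite le_max lexx.
apply: (@measurable_fun_fubini_tonelli_G _ _ Omega (measurableTypeR R) R P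
  (fun z : Omega * measurableTypeR R => (F (state (Num.max 0 z.2) z.1))%:E)).
- apply/measurable_EFinP; apply: (measurableT_comp mF).
  apply: (measurable_state W_fbm sigma x u (tau := fun z : Omega * measurableTypeR R =>
     Num.max 0 (z.2 : R)) (om := fst)) => //.
  by move=> z; rewrite le_max lexx.
- by move=> z; rewrite lee_fin.
Qed.

Lemma expectation_running T : 0 <= T ->
  (\int[P]_w (\int[mu]_(t in `[0, T]) F (state t w))%:E =
   (\int[mu]_(t in `[0, T]) mean_at (Num.max 0 t))%:E)%E.
Proof.
move=> T0.
under eq_integral do rewrite -inner_integrand//.
rewrite (fubini_tonelli (m1 := P) (m2 := mu) (integrand T))//.
rewrite /Rintegral fineK; last first.
  apply: integrable_fin_num => //.
  apply: (bounded_integrable_itv measurable_mean_at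
    (K := \int[P]_w F (x + peak w))) => // t t0.
  rewrite ger0_norm ?state_mean_ge0//; apply: state_mean_bounded; try eassumption.
  by rewrite le_max lexx.
rewrite [RHS]integral_mkcond; apply: eq_integral => t _.
rewrite patchE /integrand/= indicE; case: ifPn => tT; last first.
  by under eq_integral do rewrite mulr0; rewrite integral0.
under eq_integral do rewrite mulr1.
by apply: (state_meanE H_range W_fbm u0 x0 sigma0 cF F0 ndF q0 FK); rewrite le_max lexx.
Qed.

Lemma average_running_cvg :
  T^-1 * \int[mu]_(t in `[0, T]) mean_at (Num.max 0 t) @[T --> +oo]
    --> \int[P]_w F (peak w).
Proof.
apply: (cesaro_cvg (B := \int[P]_w F (x + peak w)) measurable_mean_at).
- move=> t t0; rewrite ger0_norm ?state_mean_ge0//.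
  by apply: state_mean_bounded; try eassumption; rewrite le_max lexx.
- have lim := state_mean_cvg H_range W_fbm u0 x0 sigma0 cF F0 ndF q0 FK.
  apply: cvg_trans lim; apply: near_eq_cvg; near=> t.
  congr (state_mean _ _ _ _ _ _); apply/esym/max_idPr.
  by near: t; exact: nbhs_pinfty_ge.
Unshelve. all: by end_near. Qed.

End running_integral.

(** On states this is the identity, and it is nonnegative on the whole line: the
    convergence of [E F(state)] applied to it gives the mean of the state. *)
Let pos (y : R) : R := Num.max 0 y.

Let cpos : continuous pos.
Proof.
move=> y; apply: (continuous_max (f := cst 0 : R -> R^o) (g := idfun)).
  exact: cvg_cst.
exact: cvg_id.
Qed.

Let pos0 y : 0 <= pos y. Proof. by rewrite le_max lexx. Qed.

Let ndpos : {homo pos : y z / y <= z}.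
Proof. by move=> y z yz; rewrite /pos ge_max !le_max lexx yz orbT. Qed.

Let posK y : 0 <= y -> pos y <= 1 * (1 + y ^+ 1).
Proof. by move=> y0; rewrite /pos (max_idPr y0) mul1r expr1 lerDr. Qed.

Let mean_state T : R := state_mean W sigma u x pos T.

Let mean_stateE T : 0 <= T -> (\int[P]_w (state T w)%:E = (mean_state T)%:E)%E.
Proof.
move=> T0; rewrite -(state_meanE H_range W_fbm u0 x0 sigma0 cpos pos0 ndpos (ltn0Sn 0) posK T0).
by apply: eq_integral => w _; rewrite /pos (max_idPr (state_ge0 w T0)).
Qed.

Let m_state T : 0 <= T -> measurable_fun setT (state T).
Proof.
move=> T0.
by apply: (measurable_state W_fbm sigma x u (tau := fun=> T) (om := idfun)) => //; exact: measurable_id.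
Qed.

Let regulatorE T w : regulator W sigma x u T w =
  state T w - x + u * T - sigma u * W T w.
Proof. by rewrite /Defs.state /netput; ring. Qed.

Let regulator_ge0 T w : 0 <= regulator W sigma x u T w.
Proof. by rewrite /regulator oppr_ge0 ge_min lexx. Qed.

Lemma measurable_regulator T : 0 <= T -> measurable_fun setT (regulator W sigma x u T).
Proof.
move=> T0; rewrite (funext (regulatorE T)).
apply: measurable_funB.
  by apply: measurable_funD => //; apply: measurable_funB => //; exact: m_state.
by apply: measurable_funM => //; exact: measurable_funPT.
Qed.

(** [W T] is centred. *)
Lemma expectation_regulator T : 0 <= T ->
  (\int[P]_w (regulator W sigma x u T w)%:E = (mean_state T - x + u * T)%:E)%E.
Proof.
move=> T0.
have is_ : P.-integrable setT (EFin \o state T).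
  apply/integrableP; split; first by apply/measurable_EFinP; exact: m_state.
  under eq_integral do rewrite /= ger0_norm ?state_ge0//.
  by rewrite mean_stateE// ltry.
have iW : P.-integrable setT (EFin \o W T).
  exact: square_integrable_integrable (W_square_integrable W_fbm T0).
have icst k : P.-integrable setT (EFin \o cst k) by exact: (@bounded_integrable _ _ _ _ _ `|k|).
have i1 : P.-integrable setT (EFin \o (fun w => state T w + (u * T - x))).
  exact: (integrableD measurableT is_ (icst (u * T - x))).
have i2 : P.-integrable setT (EFin \o (fun w => sigma u * W T w)).
  exact: (integrableZl measurableT (sigma u) iW).
under eq_integral do rewrite regulatorE.
have -> : (fun w => (state T w - x + u * T - sigma u * W T w)%:E) =
    (EFin \o (fun w => (state T w + (u * T - x)) - sigma u * W T w)).
  by apply/funext => w /=; congr EFin; ring.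
have i3 : P.-integrable setT (EFin \o (fun w => (state T w + (u * T - x)) - sigma u * W T w)).
  exact: (integrableB measurableT i1 i2).
rewrite -(fineK (integrable_fin_num measurableT i3)); congr EFin.
rewrite -[LHS]/(\int[P]_w ((state T w + (u * T - x)) - sigma u * W T w)).
rewrite RintegralB// RintegralD//; last exact: icst.
rewrite RintegralZl// (W_mean W_fbm T0) mulr0 subr0.
rewrite Rintegral_cst// [X in _ * fine X]probability_setT mulr1.
rewrite [X in X + _](_ : _ = mean_state T); first by ring.
by rewrite /Rintegral mean_stateE.
Qed.

(** The mean of the state converges, so divided by [T] it vanishes. *)
Lemma regulator_rate :
  T^-1 * (mean_state T - x + u * T) @[T --> +oo] --> u.
Proof.
have invT : T^-1 @[T --> +oo] --> (0 : R).
  apply/(gtr0_cvgV0 (f := fun T : R => T)); last exact: cvg_id.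
  by near=> T; near: T; exact: nbhs_pinfty_gt.
have lim := state_mean_cvg H_range W_fbm u0 x0 sigma0 cpos pos0 ndpos (ltn0Sn 0) posK.
have : T^-1 * (mean_state T - x) + u @[T --> +oo] -->
    0 * (\int[P]_w pos (peak w) - x) + u.
  apply: cvgD; last exact: cvg_cst.
  by apply: cvgM => //; apply: cvgB => //; exact: cvg_cst.
rewrite mul0r add0r; apply: cvg_trans; apply: near_eq_cvg; near=> T.
have T0 : 0 < T by near: T; exact: nbhs_pinfty_gt.
by rewrite [RHS]mulrDr [T^-1 * (u * T)]mulrCA mulVf ?mulr1// gt_eqF.
Unshelve. all: by end_near. Qed.

Section cost_rate.
Variables (C : R -> R) (K : R) (q : nat) (p : R).
Let F (y : R) : R := C (Num.max 0 y).
Hypothesis p0 : 0 <= p.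
Hypothesis cF : continuous F.
Hypothesis F0 : forall y, 0 <= F y.
Hypothesis ndF : {homo F : y z / y <= z}.
Hypothesis q0 : (0 < q)%N.
Hypothesis FK : forall y, 0 <= y -> F y <= K * (1 + y ^+ q).

Lemma expectation_running_cost T : 0 <= T ->
  ('E_P[running_cost W sigma C p x u T] =
   (\int[mu]_(t in `[0, T]) state_mean W sigma u x F (Num.max 0 t) +
    p * (mean_state T - x + u * T))%:E)%E.
Proof.
move=> T0; rewrite unlock EFinD -(expectation_running cF F0 ndF q0 FK T0).
rewrite EFinM -expectation_regulator// -ge0_integralZl//; last 2 first.
- by apply/measurable_EFinP; exact: measurable_regulator.
- by move=> w _; rewrite lee_fin.
rewrite -ge0_integralD; last 5 first.
- exact: measurableT.
- by move=> w _; rewrite lee_fin; apply: Rintegral_ge0.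
- by apply/measurable_EFinP; exact: (measurable_running cF F0 ndF).
- by move=> w _; rewrite -EFinM lee_fin mulr_ge0.
- by apply: measurable_funeM; apply/measurable_EFinP; exact: measurable_regulator.
apply: eq_integral => w _; rewrite /running_cost -EFinM -EFinD; congr (_ + _)%:E.
apply: eq_Rintegral => t; rewrite inE/= in_itv/= => /andP[t0 _].
by rewrite /F (max_idPr (state_ge0 w t0)).
Qed.

Lemma cost_limsup :
  limf_esup (fun T : R => (T^-1)%:E * 'E_P[running_cost W sigma C p x u T])%E +oo =
  (p * u + \int[P]_w F (peak w))%:E.
Proof.
apply: cvg_limf_esup.
have lim1 := average_running_cvg cF F0 ndF q0 FK.
have lim : T^-1 * \int[mu]_(t in `[0, T]) state_mean W sigma u x F (Num.max 0 t) +
    p * (T^-1 * (mean_state T - x + u * T)) @[T --> +oo] -->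
    \int[P]_w F (peak w) + p * u.
  by apply: cvgD => //; apply: cvgMr; exact: regulator_rate.
rewrite addrC; apply: cvg_EFin.
  near=> T; have T0 : 0 <= T by near: T; exact: nbhs_pinfty_ge.
  by rewrite expectation_running_cost.
apply: cvg_trans lim; apply: near_eq_cvg; near=> T.
have T0 : 0 <= T by near: T; exact: nbhs_pinfty_ge.
by rewrite /= expectation_running_cost//= [RHS]mulrDr (mulrCA p).
Unshelve. all: by end_near. Qed.

Lemma peak_expectation :
  (\int[P]_w F (peak w))%:E = G W C (scaled_rate H sigma u).
Proof.
have mp := measurable_peak W_fbm.
rewrite /G unlock all_time_maxE.
rewrite (eq_integral (fun w => (F (fbm_peak W 1 (scaled_rate H sigma u) w))%:E)); last first.
  by move=> w _; rewrite /F (max_idPr (peak_ge0 W_fbm _ _ _)).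
rewrite /Rintegral fineK.
  apply: ge0_expectation_same_law => //; first exact: (peak_same_law H_range W_fbm).
  exact: continuous_measurable_fun.
have ip := dominating_integrable H_range W_fbm u0 (lexx 0) sigma0 cF F0 q0 FK.
by have := integrable_fin_num measurableT ip; under eq_integral do rewrite add0r.
Qed.

End cost_rate.

End long_run_cost.

(** Replacing the real exponent by an integer leaves only integer moments of the
    maximum to be bounded. *)
Lemma powR_le_power (R : realType) (y gamma : R) : 0 < gamma -> 0 <= y ->
  y `^ gamma <= 1 + y ^+ (Num.truncn gamma).+1.
Proof.
move=> g0 y0; have [y1|/ltW y1] := leP y 1.
  apply: (@le_trans _ _ 1); last by rewrite lerDl exprn_ge0.
  have <- : (1 : R) `^ gamma = 1 by rewrite powR1.
  by apply: ge0_ler_powR; rewrite ?nnegrE// ltW.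
apply: (@le_trans _ _ (y ^+ (Num.truncn gamma).+1)); last by rewrite lerDr.
rewrite -powR_mulrn//; apply: ler_powR => //.
by have /andP[_ /ltW] := truncn_itv (ltW g0).
Qed.

Theorem theorem3p6 (d : measure_display) (Omega : measurableType d)
  (R : realType) (P : probability Omega R)
  (H : R) (W : R -> {RV P >-> R}) (sigma h C : R -> R) (p : R)
  (H_range : 2^-1 <= H < 1)
  (W_fbm : fractional_brownian_motion H W)
  (sigma_gt0 : forall u, 0 <= u -> 0 < sigma u)
  (sigma_cont : {within `[0, +oo[, continuous sigma})
  (p_ge0 : 0 <= p)
  (h_ge0 : forall u, 0 <= u -> 0 <= h u)
  (h_cont : {within `[0, +oo[, continuous h})
  (h_ndecr : {in `[0, +oo[ &, {homo h : u v / u <= v}})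
  (h_lim : h u @[u --> +oo] --> +oo)
  (C_ge0 : forall y, 0 <= y -> 0 <= C y)
  (C_cont : {within `[0, +oo[, continuous C})
  (C_ndecr : {in `[0, +oo[ &, {homo C : y z / y <= z}})
  (C_growth : exists K gamma : R, [/\ 0 < K, 0 < gamma &
     forall y, 0 <= y -> C y <= K * (1 + y `^ gamma)]) :
  (forall u x : R, 0 < u -> 0 <= x ->
     cost W sigma h C p u x
     = ((h u)%:E + (p * u)%:E + G W C (scaled_rate H sigma u))%E)
  /\
  (forall u x y : R, 0 < u -> 0 <= x -> 0 <= y ->
     cost W sigma h C p u x = cost W sigma h C p u y).
Proof.
have formula (u x : R) : 0 < u -> 0 <= x -> cost W sigma h C p u x
     = ((h u)%:E + (p * u)%:E + G W C (scaled_rate H sigma u))%E.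
  move=> u0 x0; have sigma0 := sigma_gt0 u (ltW u0).
  have [K [gamma [K0 gamma0 CK]]] := C_growth.
  pose q := (Num.truncn gamma).+1.
  have cF : continuous (fun y : R => C (Num.max 0 y)) by exact: continuous_max0.
  have F0 (y : R) : 0 <= C (Num.max 0 y) by apply: C_ge0; rewrite le_max lexx.
  have ndF : {homo (fun y : R => C (Num.max 0 y)) : y z / y <= z}.
    move=> y z yz; apply: C_ndecr; try by rewrite in_itv/= andbT le_max lexx.
    by rewrite ge_max !le_max lexx yz orbT.
  have FK (y : R) : 0 <= y -> C (Num.max 0 y) <= (2 * K) * (1 + y ^+ q).
    move=> y0; rewrite (max_idPr y0); apply: le_trans (CK y y0) _.
    rewrite (mulrC 2) -mulrA ler_wpM2l ?(ltW K0)//.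
    have := powR_le_power gamma0 y0; have := exprn_ge0 q y0; rewrite -/q; lra.
  rewrite /cost (cost_limsup H_range W_fbm u0 x0 sigma0 p_ge0 cF F0 ndF (ltn0Sn _) FK).
  rewrite EFinD (peak_expectation H_range W_fbm u0 sigma0 cF F0 (ltn0Sn _) FK).
  by rewrite addeA.
split; first exact: formula.
by move=> u x y u0 x0 y0; rewrite (formula u x)// (formula u y).
Qed.
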